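(* Let $\zeta$ be a primitive aperiodic substitution of constant length $q\geq2$ on an alphabet of two letters, and let $I=\chi_\zeta^+$ be the (almost everywhere constant) top Lyapunov exponent of its spectral cocycle. There exists a constant $B>0$ such that for Lebesgue almost every $\omega\in[0,1)$ there exists a positive integer $n_0(\omega)$ such that for all $n\geq n_0(\omega)$, $$e^{-B\sqrt{n\log\log(n)}}\leq\frac{\|\mathscr{C}_\zeta(\omega\vec 1,n)\|}{e^{nI}}\leq e^{B\sqrt{n\log\log(n)}}.$$
   Context: Let $\mathcal{A}$ be a finite alphabet and $\mathcal{A}^+$ the set of finite non-empty words on $\mathcal{A}$. A substitution is a map $\zeta:\mathcal{A}\to\mathcal{A}^+$, extended to words by concatenation; it has constant length $q$ if $|\zeta(a)|=q$ for all $a\in\mathcal{A}$. With $|w|_a$ the number of occurrences of the letter $a$ in the word $w$, the substitution matrix is $M_\zeta(a,b)=|\zeta(b)|_a$, and $\zeta$ is primitive if some power of $M_\zeta$ has only positive entries. The subshift $X_\zeta$ is the set of $(x_n)_{n\in\mathbb{Z}}\in\mathcal{A}^{\mathbb{Z}}$ all of whose finite subwords are subwords of some $\zeta^n(a)$, $a\in\mathcal{A}$, $n\in\mathbb{N}$; $\zeta$ is aperiodic if $X_\zeta$ contains no shift-periodic sequence. Spectral cocycle. Write $e(x)=e^{2\pi i x}$, $m=\#\mathcal{A}$ (here $m=2$) and $\zeta(a)=w_1\dots w_{k_a}$. For $\xi\in(\mathbb{R}/\mathbb{Z})^m$, indexed by letters, let $\mathscr{C}_\zeta(\xi,1)$ be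 the $m\times m$ matrix with entries $$\mathscr{C}_\zeta(\xi,1)(a,b)=\sum_{j=1}^{k_a}\delta_{w_j,b}\,e(\xi_{w_1}+\dots+\xi_{w_{j-1}}),$$ where $\delta$ is the Kronecker delta, and let $\mathscr{C}_\zeta(\xi,n)=\mathscr{C}_\zeta((M_\zeta^T)^{n-1}\xi,1)\cdots\mathscr{C}_\zeta(\xi,1)$. With $\vec 1=(1,\dots,1)^T$, the pointwise top Lyapunov exponent is $\chi_\zeta^+(\omega)=\limsup_{n\to\infty}\frac1n\log\|\mathscr{C}_\zeta(\omega\vec 1,n)\|$. For constant length substitutions it is Lebesgue-almost everywhere equal to a constant, denoted $\chi_\zeta^+$. Here $\|\cdot\|$ is any fixed matrix norm. *)

(* Defs.v *)
From HB Require Import structures.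
From mathcomp Require Import all_boot all_order all_algebra.
From mathcomp Require Import complex.
From mathcomp Require Import all_classical all_reals all_analysis.

Set Implicit Arguments.
Unset Strict Implicit.
Unset Printing Implicit Defensive.

Import Order.TTheory GRing.Theory Num.Theory.
Local Open Scope classical_set_scope.
Local Open Scope ring_scope.
Local Open Scope complex_scope.

Section Substitution.
Variable m : nat.
Implicit Types zeta : 'I_m -> seq 'I_m.

Definition is_substitution zeta := forall a, zeta a != [::].

Definition constant_length zeta (q : nat) := forall a, size (zeta a) = q.

Definition subst_word zeta (w : seq 'I_m) : seq 'I_m := flatten (map zeta w).

Definition subst_matrix zeta : 'M[nat]_m :=
  \matrix_(a, b) count_mem a (zeta b).

Definition primitive_subst zeta :=
  exists2 k : nat, (0 < k)%N &
    forall a b, (0 < (subst_matrix zeta ^+ k)%R a b)%N.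

Definition in_language zeta (w : seq 'I_m) :=
  exists (n : nat) (a : 'I_m), infix w (iter n (subst_word zeta) [:: a]).

Definition subshift zeta : set (int -> 'I_m) :=
  [set x | forall (k : int) (l : nat),
             in_language zeta [seq x (k + i%:Z) | i <- iota 0 l]].

Definition shift_periodic (x : int -> 'I_m) :=
  exists2 p : nat, (0 < p)%N & forall k : int, x (k + p%:Z) = x k.

Definition aperiodic_subst zeta :=
  forall x, subshift zeta x -> ~ shift_periodic x.

End Substitution.

Section SpectralCocycle.
Variables (R : realType) (m : nat).
Implicit Types zeta : 'I_m -> seq 'I_m.

Definition e (x : R) : R[i] := cos (2 * pi * x) +i* sin (2 * pi * x).

(* Points of the torus (R/Z)^m are given by real representatives; this is
   harmless since [e] is 1-periodic and the substitution matrix is integral. *)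
Definition cocycle1 zeta (xi : 'cV[R]_m) : 'M[R[i]]_m :=
  \matrix_(a, b) \sum_(j < size (zeta a))
    (nth a (zeta a) j == b)%:R * e (\sum_(c <- take j (zeta a)) xi c 0).

Fixpoint cocycle zeta (xi : 'cV[R]_m) (n : nat) : 'M[R[i]]_m :=
  if n is k.+1 then
    cocycle1 zeta
      ((map_mx (fun i : nat => i%:R) (subst_matrix zeta))^T ^+ k *m xi)
      *m cocycle zeta xi k
  else 1%:M.

(* Submultiplicativity is not required: the results do not depend on it. *)
Definition is_matrix_norm (N : 'M[R[i]]_m -> R) :=
  [/\ forall A, N A = 0 -> A = 0,
      forall A B, N (A + B) <= N A + N B &
      forall (c : R[i]) A, (N (c *: A))%:C = `|c| * (N A)%:C].

(* [lne] is used so that the logarithm of a vanishing norm is -oo. *)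
Definition pointwise_lyapunov (N : 'M[R[i]]_m -> R) zeta (w : R) : \bar R :=
  limn_esup (fun n : nat =>
    ((n%:R)^-1)%:E * lne (N (cocycle zeta (const_mx w) n))%:E)%E.

(* The almost everywhere value of [pointwise_lyapunov]; it is unique when it
   exists, and 0 is a dummy value for when it does not. *)
Definition lyapunov (N : 'M[R[i]]_m -> R) zeta : R :=
  xget 0 [set chi : R |
    {ae @lebesgue_measure R, forall w, pointwise_lyapunov N zeta w = chi%:E}].

End SpectralCocycle.

(* Main.v *)
Require Import Defs.
From HB Require Import structures.
From mathcomp Require Import all_boot all_order all_algebra.
From mathcomp Require Import complex ring lra zify.
From mathcomp Require Import all_classical all_reals all_analysis.
From mathcomp Require Import measurable_realfun.
Set Implicit Arguments.
Unset Strict Implicit.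
Unset Printing Implicit Defensive.
Import Order.TTheory GRing.Theory Num.Theory.
Import numFieldNormedType.Exports ComplexField.Normc.
Local Open Scope classical_set_scope.
Local Open Scope ring_scope.

(** For a substitution of constant length the diagonal of the torus is invariant,
and on it the cocycle is a product of the one-step matrices [C(q^k w)].  With
two letters these matrices are simultaneously triangular.  Both rows of [C(t)]
sum to the Dirichlet kernel [S(t) = 1 + e(t) + ... + e((q-1)t)], so [(1, 1)]
is a common right eigenvector, and [(-1, 1)] is a common left eigenvector, with
eigenvalue [p(e(t))] for a polynomial [p] with coefficients in [{-1, 0, 1}],
which is nonzero because an aperiodic substitution has [zeta 0 <> zeta 1].
The product of the kernels telescopes to [(e(q^n w) - 1) / (e(w) - 1)]; the
product [D_n] of the [p(e(q^k w))] carries the growth.  Bounding the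
off-diagonal entry by the same recursion gives, up to constants that depend on
[w], [|D_n| <= norm <= sum_(k <= n) |D_k| / |e(q^(k+1) w) - 1|]
([normc_diff_prod_le], [normc_cocycle_le]).

So the theorem is an iterated logarithm bound for the Birkhoff sums of
[ln |p(e(x))|] under [T x = q x] ([lil_poly]); the exponent is the logarithmic
Mahler measure of [p].  The leading coefficient of [p] is [1] or [-1], and
factoring [p] reduces the bound to the functions [f_a(x) = ln |e(x) - a|].  A
root outside the unit disc is reflected into it, at the price of a constant
[ln |a| >= 0]; hence the exponent is nonnegative, and the terms [|D_k|] with
[k <= n] do not exceed the expected size of [|D_n|].  The function [f_1]
controls the denominators.

Let [|a| <= 1] ([lil_lnd]), and let [L] be the transfer operator, the average
over the [q] preimages.  Since the product of the [e(y) - a] over the preimages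
[y] of [x] is [e(x) - a^q] up to sign, [L f_a = f_(a^q) / q].  With
[a_i = a^(q^i)] this reads [f_(a_i) = g_i + (f_(a_(i+1)) o T) / q] where
[L g_i = 0]: up to geometrically decreasing weights, the Birkhoff sums of
[f_a] are sums of martingale differences for the decreasing filtration of
[T].  The logarithmic singularities make [g_i] unbounded, even conditionally,
so a self-normalized inequality is used: as [exp(y - y^2) <= 1 + y + y^2], the
process [exp(l S_n g - l^2 S_n V)] with [V = g^2 + L(g^2) o T] is a
supermartingale for every real [l], and stopping it gives a maximal inequality
([maximal_function]).

It remains to see that [S_n V] is of order [n].  The function [V] is
dominated by squares of the positive functions [u_a = 2 ln 2 - f_a], and a sum
of squares of nonnegative numbers is at most the square of the sum, so
[L(u_a^2) <= (3/4) u_(a^q)^2 + const].  Iterating this drift inequality through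
the levels leaves martingale differences that are controlled in square mean
([int01_orbit_sum_mart_diff]) by a fourth moment of [u_a] that is uniform in
[a] ([int01_pot4]).  At the scale [n = 2^k] one takes [l = sqrt(ln k / n)] and
the failure probability [(k + 1)^(-3)] for each of the [2k] levels; the total is
summable, and the Borel-Cantelli lemma concludes ([lil_dyadic]). *)

(** * Affine changes of variables and the transfer operator *)

Section AffineChange.
Variable R : realType.
Local Notation mu := (@lebesgue_measure R).

Definition affine_map (a b : R) (x : measurableTypeR R) : measurableTypeR R := a * x + b.

Lemma measurable_affine_map a b : measurable_fun setT (affine_map a b).
Proof.
apply: measurable_funD => //; apply: measurable_funM => //.
Qed.

Lemma lebesgue_measure_affine (a b : R) (a0 : 0 < a) (A : set (measurableTypeR R)) :
  measurable A -> mu A = (a%:E * mu (affine_map a b @^-1` A))%E.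
Proof.
move=> mA.
pose m := mscale (NngNum (ltW a0)) (pushforward mu (affine_map a b)).
rewrite (@lebesgue_measure_unique R (m (measurable_affine_map a b))) // => X.
case=> -[c d] _ <- /=.
rewrite /m /mscale /= /pushforward.
have -> : affine_map a b @^-1` `]c, d] = `](c - b) / a, (d - b) / a]%classic.
  apply/seteqP; split => x; rewrite /= !in_itv /= ltr_pdivrMr // ler_pdivlMr //
     /affine_map ltrBlDr lerBrDr mulrC //.
rewrite !lebesgue_measure_itv /= !lte_fin ltr_pM2r ?invr_gt0 // ltrD2r.
case: ifP => _; last by rewrite mule0.
rewrite -!EFinD -EFinM; congr (_%:E).
by field; rewrite gt_eqF.
Qed.

Lemma ge0_integral_affine (a b : R) (D : set R) (f : R -> \bar R) : 0 < a ->
  measurable D -> measurable_fun D f -> (forall x, D x -> (0 <= f x)%E) ->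
  (\int[mu]_(x in D) f x =
   a%:E * \int[mu]_(x in [set x | D (a * x + b)%R]) f (a * x + b)%R)%E.
Proof.
move=> a0 mD mf f0.
pose m := mscale (NngNum (ltW a0)) (pushforward mu (affine_map a b)).
have -> : (\int[mu]_(x in D) f x = \int[m (measurable_affine_map a b)]_(x in D) f x)%E.
  apply: eq_measure_integral => A mA _.
  by rewrite /m /mscale /=; exact: lebesgue_measure_affine.
rewrite /m ge0_integral_mscale //.
rewrite (@ge0_integral_pushforward _ _ _ _ _ _ (measurable_affine_map a b)) //.
by move=> y /set_mem; exact: f0.
Qed.
End AffineChange.

Section Transfer.
Variable R : realType.
Local Notation mu := (@lebesgue_measure R).
Implicit Types f g : R -> R.

Definition int01 f : \bar R := (\int[mu]_(x in `[0%R, 1%R[) (f x)%:E)%E.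

(** The dual, with respect to Lebesgue measure on [[0, 1)], of composition with
multiplication by [q]. *)
Definition transfer (q : nat) f (x : R) : R :=
  q%:R^-1 * \sum_(j < q) f ((x + j%:R) / q%:R).

Definition periodic1 f := forall x, f (x + 1) = f x.

Lemma measurable_comp_affine f (a b : R) :
  measurable_fun setT f -> measurable_fun setT (fun x => f (a * x + b)).
Proof. by move=> mf; apply: (measurableT_comp mf); exact: measurable_affine_map. Qed.

Lemma measurable_EFinS (D : set R) f :
  measurable_fun setT f -> measurable_fun D (fun x => (f x)%:E).
Proof.
move=> mf; change (measurable_fun D (EFin \o f)).
by apply: measurableT_comp => //; exact: measurable_funTS.
Qed.

Lemma measurable_sumr (I : Type) (s : seq I) (F : I -> R -> R) :
  (forall i, measurable_fun setT (F i)) ->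
  measurable_fun setT (fun x => \sum_(i <- s) F i x).
Proof. by move=> mF; exact: measurable_sum. Qed.

Lemma measurable_scalel f (c : R) :
  measurable_fun setT f -> measurable_fun setT (fun x => c * f x).
Proof. by move=> mf; apply: measurable_funM. Qed.

Lemma measurable_transfer q f :
  measurable_fun setT f -> measurable_fun setT (transfer q f).
Proof.
move=> mf; apply: measurable_scalel.
apply: measurable_sumr => j.
rewrite (_ : (fun x => _) = (fun x => f (q%:R^-1 * x + j%:R / q%:R))).
  exact: measurable_comp_affine.
by apply/funext => x; rewrite mulrDl [_^-1 * _]mulrC.
Qed.

Lemma measurable_mulq f (c : R) :
  measurable_fun setT f -> measurable_fun setT (fun x => f (c * x)).
Proof.
move=> mf; rewrite (_ : (fun x => _) = (fun x => f (c * x + 0))).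
  exact: measurable_comp_affine.
by apply/funext => x; rewrite addr0.
Qed.

Lemma transfer_ge0 q f x : (forall y, 0 <= f y) -> 0 <= transfer q f x.
Proof. by move=> f0; rewrite mulr_ge0 ?invr_ge0 // sumr_ge0. Qed.

Lemma le_transfer q f g x : (forall y, f y <= g y) -> transfer q f x <= transfer q g x.
Proof. by move=> fg; rewrite ler_wpM2l ?invr_ge0 // ler_sum. Qed.

Lemma eq_transfer q f g x : f =1 g -> transfer q f x = transfer q g x.
Proof. by move=> fg; congr (_ * _); apply: eq_bigr => i _. Qed.

Lemma transferD q f g x :
  transfer q (fun y => f y + g y) x = transfer q f x + transfer q g x.
Proof. by rewrite /transfer big_split mulrDr. Qed.

Lemma transferZ q c f x :
  transfer q (fun y => c * f y) x = c * transfer q f x.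
Proof. by rewrite /transfer -mulr_sumr mulrCA. Qed.

Lemma periodic1_nat f (n : nat) x : periodic1 f -> f (x + n%:R) = f x.
Proof.
move=> pf; elim: n => [|n IH]; first by rewrite addr0.
by rewrite -natr1 addrA pf.
Qed.

Lemma periodic1_mulq f (q : nat) : periodic1 f -> periodic1 (fun x => f (q%:R * x)).
Proof. by move=> pf x; rewrite mulrDr mulr1 periodic1_nat. Qed.

(** Periodic functions of [q y] are constant on the preimages of [x]: they play the
role of the scalars that can be pulled out of a conditional expectation. *)
Lemma transfer_mulq q f g x : (0 < q)%N -> periodic1 g ->
  transfer q (fun y => f y * g (q%:R * y)) x = transfer q f x * g x.
Proof.
move=> q0 pg; rewrite /transfer -mulrA mulr_suml; congr (_ * _).
apply: eq_bigr => j _; rewrite [q%:R * _]mulrC mulfVK ?pnatr_eq0 -?lt0n //.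
by rewrite periodic1_nat.
Qed.

Lemma transfer_cst q (c : R) x : (0 < q)%N -> transfer q (fun=> c) x = c.
Proof.
move=> q0; rewrite /transfer sumr_const card_ord -[c *+ q]mulr_natl mulrA mulVf ?mul1r//.
by rewrite pnatr_eq0 -lt0n.
Qed.

Lemma transfer_comp_mulq q g x : (0 < q)%N -> periodic1 g ->
  transfer q (fun y => g (q%:R * y)) x = g x.
Proof.
move=> q0 pg; have := @transfer_mulq q (fun=> 1) g x q0 pg.
rewrite transfer_cst // mul1r => <-.
by apply: eq_transfer => y; rewrite mul1r.
Qed.

(** The branches [x |-> (x + j) / q] map [[0, 1)] onto the consecutive intervals
[[j / q, (j + 1) / q)], which tile [[0, 1)]. *)
Lemma int01_transfer q f : (0 < q)%N -> measurable_fun setT f ->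
  (forall x, 0 <= f x) -> int01 (transfer q f) = int01 f.
Proof.
move=> q0 mf f0; have q0R : 0 < q%:R :> R by rewrite ltr0n.
have fE D : measurable_fun D (EFin \o f) by apply: measurableT_comp => //; exact: measurable_funTS.
have mfj j : measurable_fun setT (fun x : R => f ((x + j%:R) / q%:R)).
  rewrite (_ : (fun x => _) = (fun x => f (q%:R^-1 * x + j%:R / q%:R))).
    exact: measurable_comp_affine.
  by apply/funext => x; rewrite mulrDl [_^-1 * _]mulrC.
have Hsplit n : (\int[mu]_(x in `[0%R, (n%:R / q%:R)%R[) (f x)%:E =
    \sum_(j < n) (q%:R^-1)%:E * int01 (fun x => f ((x + j%:R) / q%:R))%R)%E.
  elim: n => [|n IH].
    by rewrite mul0r set_itvco0 integral_set0 big_ord0.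
  rewrite big_ord_recr -IH /=.
  have -> : `[0%R, (n.+1%:R / q%:R)%R[%classic =
      `[0%R, (n%:R / q%:R)%R[ `|` `[(n%:R / q%:R)%R, (n.+1%:R / q%:R)%R[ :> set R.
    by rewrite -itv_bndbnd_setU // bnd_simp ?divr_ge0 // ler_pM2r ?invr_gt0 // ler_nat.
  rewrite ge0_integral_setU //=; last 2 first.
  - by move=> x _; rewrite lee_fin.
  - rewrite disj_set2E; apply/eqP/seteqP; split => x //= [].
    by rewrite !in_itv /= => /andP[_ h1] /andP[h2 _]; move: (lt_le_trans h1 h2); rewrite ltxx.
  congr (_ + _)%E.
  rewrite (@ge0_integral_affine R q%:R^-1 (n%:R / q%:R) _ (EFin \o f)) ?invr_gt0 //; last first.
    by move=> x _; rewrite lee_fin.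
  congr (_ * _)%E; rewrite /int01.
  have -> : [set x : R | `[(n%:R / q%:R)%R, (n.+1%:R / q%:R)%R[%classic (q%:R^-1 * x + n%:R / q%:R)%R] = `[0%R, 1%R[%classic.
    apply/seteqP; split => x; rewrite /= !in_itv /= [_^-1 * x]mulrC -mulrDl ler_pM2r ?invr_gt0 // ltr_pM2r ?invr_gt0 //
      -natr1 [x + _]addrC lerDl ltrD2l //.
  by apply: eq_integral => x _ /=; rewrite [_^-1 * x]mulrC -mulrDl.
  exact: fE.
have := Hsplit q; rewrite divff ?gt_eqF // => h; rewrite {2}/int01 h.
rewrite /int01 /transfer -ge0_sume_distrr; last first.
  by move=> i _; apply: integral_ge0 => x _; rewrite lee_fin.
under eq_integral do rewrite EFinM.
rewrite ge0_integralZl_EFin //; last 2 first.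
- by move=> x _; rewrite lee_fin sumr_ge0.
- by apply: measurableT_comp => //; apply: measurable_funTS; exact: measurable_sumr.
congr (_ * _)%E.
under eq_integral do rewrite -sumEFin.
rewrite ge0_integral_sum // => j; last by move=> x _; rewrite lee_fin.
by apply: measurable_EFinS; exact: mfj.
Qed.

Lemma int01_mulq q f : (0 < q)%N -> measurable_fun setT f -> periodic1 f ->
  (forall x, 0 <= f x) -> int01 (fun x => f (q%:R * x)) = int01 f.
Proof.
move=> q0 mf pf f0; rewrite -(@int01_transfer q) //; last exact: measurable_mulq.
by congr int01; apply/funext => x; exact: transfer_comp_mulq.
Qed.

Lemma int01_exp q i f : (0 < q)%N -> measurable_fun setT f -> periodic1 f ->
  (forall x, 0 <= f x) -> int01 (fun x => f (q%:R ^+ i * x)) = int01 f.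
Proof.
move=> q0 mf pf f0; rewrite -natrX int01_mulq // expn_gt0 q0 //.
Qed.

Lemma le_int01 f g : measurable_fun setT f -> measurable_fun setT g ->
  (forall x, 0 <= f x) -> (forall x, f x <= g x) -> (int01 f <= int01 g)%E.
Proof.
move=> mf mg f0 fg; apply: ge0_le_integral => //.
- by move=> x _; rewrite lee_fin.
- exact: measurable_EFinS.
- exact: measurable_EFinS.
- by move=> x _; rewrite lee_fin.
Qed.

Lemma int01D f g : measurable_fun setT f -> measurable_fun setT g ->
  (forall x, 0 <= f x) -> (forall x, 0 <= g x) ->
  int01 (fun x => f x + g x) = (int01 f + int01 g)%E.
Proof.
move=> mf mg f0 g0; rewrite /int01.
under eq_integral do rewrite EFinD.
rewrite ge0_integralD //; try by move=> x _; rewrite lee_fin.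
- exact: measurable_EFinS.
- exact: measurable_EFinS.
Qed.

Lemma int01Z (c : R) f : 0 <= c -> measurable_fun setT f -> (forall x, 0 <= f x) ->
  int01 (fun x => c * f x) = (c%:E * int01 f)%E.
Proof.
move=> c0 mf f0; rewrite /int01.
under eq_integral do rewrite EFinM.
rewrite ge0_integralZl_EFin //.
- by move=> x _; rewrite lee_fin.
- exact: measurable_EFinS.
Qed.

Lemma int01_sum (I : Type) (s : seq I) (F : I -> R -> R) :
  (forall i, measurable_fun setT (F i)) -> (forall i x, 0 <= F i x) ->
  int01 (fun x => \sum_(i <- s) F i x) = (\sum_(i <- s) int01 (F i))%E.
Proof.
move=> mF F0; rewrite /int01.
under eq_integral do rewrite -sumEFin.
rewrite ge0_integral_sum // => j; last by move=> x _; rewrite lee_fin.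
exact: measurable_EFinS.
Qed.

Lemma int01_cst (c : R) : int01 (fun=> c) = c%:E.
Proof.
rewrite /int01 integral_cst //= lebesgue_measure_itv /= lte_fin ltr01.
by rewrite -EFinD subr0 mule1.
Qed.

End Transfer.

(** * Martingale differences for multiplication by q *)

Section Martingale.
Variables (R : realType) (q : nat).
Hypothesis q0 : (0 < q)%N.
Implicit Types f g : R -> R.

Lemma periodic1_transfer f : periodic1 f -> periodic1 (transfer q f).
Proof.
move=> pf x; rewrite /transfer; congr (_ * _).
have qn0 : q%:R != 0 :> R by rewrite pnatr_eq0 -lt0n.
case: q q0 qn0 => // p _ pn0.
rewrite big_ord_recr big_ord_recl /= addrC; congr (_ + _).
  by rewrite addr0 -addrA nat1r mulrDl divff // pf.
by apply: eq_bigr => j _; rewrite -addrA nat1r.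
Qed.

(** [f] minus its conditional expectation given [q x]. *)
Definition mart_diff f x := f x - transfer q f (q%:R * x).

Lemma measurable_mart_diff f :
  measurable_fun setT f -> measurable_fun setT (mart_diff f).
Proof.
move=> mf; apply: measurable_funB => //.
by apply: measurable_mulq; exact: measurable_transfer.
Qed.

Lemma periodic1_mart_diff f : periodic1 f -> periodic1 (mart_diff f).
Proof.
move=> pf x; rewrite /mart_diff pf; congr (_ - _).
exact: (periodic1_mulq q (periodic1_transfer pf)).
Qed.

Lemma transfer_mart_diff f x : periodic1 f -> transfer q (mart_diff f) x = 0.
Proof.
move=> pf; rewrite (transferD q f (fun y => - transfer q f (q%:R * y))).
rewrite (@transfer_comp_mulq _ q (fun y => - transfer q f y)) ?subrr //.
by move=> y; rewrite periodic1_transfer.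
Qed.

(** Conditional variance is at most the conditional second moment. *)
Lemma transfer_mart_diff_sqr f x : periodic1 f ->
  transfer q (fun y => mart_diff f y ^+ 2) x <= transfer q (fun y => f y ^+ 2) x.
Proof.
move=> pf; have pLf := periodic1_transfer pf.
rewrite (@eq_transfer _ q _ (fun y => f y ^+ 2 +
   (f y * ((fun z => - 2 * transfer q f z) (q%:R * y)) + (fun z => transfer q f z ^+ 2) (q%:R * y)))).
  rewrite transferD transferD (@transfer_mulq _ q f (fun z => - 2 * transfer q f z)) //;
    last by move=> y; rewrite pLf.
  rewrite (@transfer_comp_mulq _ q (fun z => transfer q f z ^+ 2)) //; last by move=> y; rewrite pLf.
  rewrite -subr_ge0; set u := transfer q f x.
  by have := sqr_ge0 u; rewrite expr2; lra.
by move=> y; rewrite /mart_diff /=; ring.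
Qed.

Definition orbit_sum g n x := \sum_(j < n) g (q%:R ^+ j * x).

Lemma orbit_sumS g n x : orbit_sum g n.+1 x = g x + orbit_sum g n (q%:R * x).
Proof.
rewrite /orbit_sum big_ord_recl expr0 mul1r; congr (_ + _).
by apply: eq_bigr => j _; rewrite mulrA -exprSr.
Qed.

Lemma measurable_orbit_sum g n : measurable_fun setT g ->
  measurable_fun setT (orbit_sum g n).
Proof. by move=> mg; apply: measurable_sumr => j; exact: measurable_mulq. Qed.

Lemma periodic1_mulqX g i : periodic1 g -> periodic1 (fun x => g (q%:R ^+ i * x)).
Proof. by move=> pg x; rewrite -natrX periodic1_mulq. Qed.

Lemma periodic1_orbit_sum g n : periodic1 g -> periodic1 (orbit_sum g n).
Proof.
by move=> pg x; apply: eq_bigr => j _; exact: (periodic1_mulqX j pg).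
Qed.

(** Orthogonality of martingale differences.  It is phrased with integrals of
nonnegative functions only: applying the transfer operator to the square of
[m + (S_n m) o T] makes the cross term vanish pointwise. *)
Lemma int01_orbit_sum_mart_diff f n : measurable_fun setT f -> periodic1 f ->
  (int01 (fun x => orbit_sum (mart_diff f) n x ^+ 2)%R <=
   n%:R%:E * int01 (fun x => f x ^+ 2)%R)%E.
Proof.
move=> mf pf; set m := mart_diff f.
have mm : measurable_fun setT m by exact: measurable_mart_diff.
have pm : periodic1 m by exact: periodic1_mart_diff.
elim: n => [|n IH].
  rewrite mul0e /orbit_sum.
  under eq_fun do rewrite big_ord0 expr0n /=.
  by rewrite int01_cst.
have mS k : measurable_fun setT (fun x : R => orbit_sum m k x ^+ 2).
  by apply: measurable_funX; exact: measurable_orbit_sum.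
have mf2 : measurable_fun setT (fun x : R => f x ^+ 2) by exact: measurable_funX.
rewrite -(@int01_transfer _ q) //; last by move=> x; exact: sqr_ge0.
have le1 x : transfer q (fun x => orbit_sum m n.+1 x ^+ 2) x <=
    transfer q (fun y => f y ^+ 2) x + orbit_sum m n x ^+ 2.
  have pS := periodic1_orbit_sum n pm.
  rewrite (@eq_transfer _ q _ (fun y => m y ^+ 2 +
     (m y * (fun z => 2 * orbit_sum m n z) (q%:R * y) + (fun z => orbit_sum m n z ^+ 2) (q%:R * y)))).
    rewrite transferD transferD (@transfer_mulq _ q m (fun z => 2 * orbit_sum m n z)) //;
      last by move=> y; rewrite pS.
    rewrite (@transfer_comp_mulq _ q (fun z => orbit_sum m n z ^+ 2)) //; last by move=> y; rewrite pS.
    by rewrite transfer_mart_diff // mul0r add0r lerD2r transfer_mart_diff_sqr.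
  by move=> y; rewrite orbit_sumS /=; ring.
apply: (@le_trans _ _ (int01 (fun x => transfer q (fun y => f y ^+ 2) x + orbit_sum m n x ^+ 2)%R)).
  apply: le_int01 => //.
  - exact: measurable_transfer.
  - by apply: measurable_funD => //; exact: measurable_transfer.
  - by move=> x; apply: transfer_ge0 => y; exact: sqr_ge0.
rewrite int01D //; last 3 first.
- exact: measurable_transfer.
- by move=> x; apply: transfer_ge0 => y; exact: sqr_ge0.
- by move=> x; exact: sqr_ge0.
rewrite int01_transfer //; last by move=> x; exact: sqr_ge0.
rewrite -natr1 EFinD ge0_muleDl ?lee_fin // mul1e addeC leeD2r //.
Qed.

(** [exp(z) <= 1 / (1 - z)] for [z < 1], and
[(1 + y + y^2) (1 - y + y^2) = 1 + y^2 + y^4]. *)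
Lemma expR_sub_sqr_le (y : R) : expR (y - y ^+ 2) <= 1 + y + y ^+ 2.
Proof.
have h : 0 < 1 - y + y ^+ 2 by nra.
apply: (@le_trans _ _ ((1 - y + y ^+ 2)^-1)).
  rewrite -[X in X <= _]invrK lef_pV2 ?posrE ?invr_gt0 ?expR_gt0 //.
  by rewrite -expRN; apply: le_trans (expR_ge1Dx _); lra.
by rewrite -[X in X <= _]mul1r ler_pdivrMr //; nra.
Qed.

(** The sum of the realized and of the predictable quadratic variation.  Having both
terms makes the exponential below a supermartingale without any exponential
moment of [g]. *)
Definition quad_var g x := g x ^+ 2 + transfer q (fun y => g y ^+ 2) (q%:R * x).

Definition exp_diff (l : R) g x := expR (l * g x - l ^+ 2 * quad_var g x).

(** The linear term of [expR_sub_sqr_le] averages to zero, and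
[1 + c <= exp(c)] absorbs the quadratic one. *)
Lemma transfer_exp_diff l g x : periodic1 g -> transfer q g x = 0 ->
  transfer q (exp_diff l g) x <= 1.
Proof.
move=> pg g0; set c := transfer q (fun y => g y ^+ 2).
have pc : periodic1 c by apply: periodic1_transfer => y; rewrite pg.
rewrite (@eq_transfer _ q _ (fun y => expR (l * g y - (l * g y) ^+ 2) *
    (fun z => expR (- (l ^+ 2 * c z))) (q%:R * y))); last first.
  by move=> y; rewrite -expRD /exp_diff /quad_var -/c; congr expR; ring.
rewrite (@transfer_mulq _ q (fun y => expR (l * g y - (l * g y) ^+ 2))
  (fun z => expR (- (l ^+ 2 * c z)))) //; last by move=> y; rewrite pc.
have le1 : transfer q (fun y => expR (l * g y - (l * g y) ^+ 2)) x <= 1 + l ^+ 2 * c x.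
  apply: (@le_trans _ _ (transfer q (fun y => 1 + (l * g y + l ^+ 2 * g y ^+ 2)) x)).
    apply: le_transfer => y; apply: le_trans (expR_sub_sqr_le _) _.
    by rewrite exprMn addrA.
  by rewrite transferD transferD !transferZ transfer_cst // g0 mulr0 add0r.
rewrite expRN ler_pdivrMr ?expR_gt0 // mul1r.
exact: le_trans le1 (expR_ge1Dx _).
Qed.

(** The supermartingale with increments [E], run from the far end of the orbit
segment [x, q x, ..., q^(n-1) x] towards [x] and frozen once it has reached
[a].  Time is reversed because the filtration generated by the [q^n x]
decreases with [n]. *)
Fixpoint stopped (a : R) (E : R -> R) (n : nat) (x : R) : R :=
  if n is k.+1 then
    if a <= stopped a E k (q%:R * x) then stopped a E k (q%:R * x)
    else E x * stopped a E k (q%:R * x)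
  else 1.

Lemma stopped_ge0 a E n x : (forall y, 0 <= E y) -> 0 <= stopped a E n x.
Proof.
move=> E0; elim: n x => [|n IH] x //=.
by case: ifP => _ //; rewrite mulr_ge0.
Qed.

Lemma periodic1_stopped a E n : periodic1 E -> periodic1 (stopped a E n).
Proof.
move=> pE; elim: n => [|n IH] x //=.
have := periodic1_mulq q IH x => /= ->.
by rewrite pE.
Qed.

Lemma measurable_stopped a E n : measurable_fun setT E ->
  measurable_fun setT (stopped a E n).
Proof.
move=> mE; elim: n => [|n IH] /=; first exact: measurable_cst.
have mq : measurable_fun setT (fun x : R => stopped a E n (q%:R * x)) by exact: measurable_mulq.
apply: measurable_fun_ifT => //.
- exact: measurable_fun_ler.
- exact: measurable_funM.
Qed.

(** Before stopping the mean does not increase because [E] has conditional mean at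
most one; after stopping the value is kept. *)
Lemma int01_stopped a E n : measurable_fun setT E -> periodic1 E ->
  (forall x, 0 <= E x) -> (forall x, transfer q E x <= 1) ->
  (int01 (stopped a E n) <= 1)%E.
Proof.
move=> mE pE E0 LE; elim: n => [|n IH]; first by rewrite int01_cst.
apply: le_trans IH.
have mS k := measurable_stopped a k mE.
have S0 k x := stopped_ge0 a k x E0.
have pS := periodic1_stopped a n pE.
rewrite -(@int01_transfer _ q) //.
apply: le_int01 => //; first exact: measurable_transfer.
  by move=> x; exact: transfer_ge0.
move=> x; set F := stopped a E n.
pose h1 z := if a <= F z then F z else 0.
pose h2 z := if a <= F z then 0 else F z.
rewrite (@eq_transfer _ q _ (fun y => h1 (q%:R * y) + E y * h2 (q%:R * y))); last first.
  by move=> y; rewrite /= /h1 /h2; case: ifP => _; rewrite ?mulr0 ?addr0 ?add0r.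
rewrite transferD (@transfer_comp_mulq _ q h1) //; last by move=> y; rewrite /h1 /F pS.
rewrite (@transfer_mulq _ q E h2) //; last by move=> y; rewrite /h2 /F pS.
rewrite (_ : F x = h1 x + h2 x); last by rewrite /h1 /h2; case: ifP; rewrite ?addr0 ?add0r.
rewrite lerD2l -[X in _ <= X]mul1r ler_wpM2r // /h2; case: ifP => // _; exact: S0.
Qed.

Lemma stopped_or a E n x : a <= stopped a E n x \/
  stopped a E n x = \prod_(j < n) E (q%:R ^+ j * x).
Proof.
elim: n x => [|n IH] x /=; first by right; rewrite big_ord0.
case: ifP => [h|nh]; first by left.
case: (IH (q%:R * x)) => [|->]; first by rewrite nh.
right; rewrite big_ord_recl expr0 mul1r; congr (_ * _).
by apply: eq_bigr => j _; rewrite mulrA -exprSr.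
Qed.

Lemma stopped_reach a E n x m : (m <= n)%N ->
  a <= \prod_(m <= j < n) E (q%:R ^+ j * x) -> a <= stopped a E n x.
Proof.
have base k y : a <= \prod_(0 <= j < k) E (q%:R ^+ j * y) -> a <= stopped a E k y.
  by rewrite big_mkord; case: (stopped_or a E k y) => [//|->].
elim: n x m => [|n IH] x [|m] mn; [exact: base | by [] | exact: base |].
rewrite big_add1 /= => h.
have {}h : a <= stopped a E n (q%:R * x).
  apply: (IH _ m) => //; congr (_ <= _) : h; apply: eq_bigr => j _.
  by rewrite mulrA -exprSr.
by rewrite h.
Qed.

(** A maximal inequality for all the tail segments [m <= j < n] at once, in the form
of a function [F] of integral at most one: by Markov's inequality the event
that some segment exceeds [a] has measure at most [1 / a]. *)
Lemma maximal_function g (l a : R) n : measurable_fun setT g -> periodic1 g ->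
  (forall x, transfer q g x = 0) ->
  exists F : R -> R, [/\ measurable_fun setT F, periodic1 F,
    forall x, 0 <= F x, (int01 F <= 1)%E &
    forall x m, (m <= n)%N -> F x < a ->
      expR (\sum_(m <= j < n)
        (l * g (q%:R ^+ j * x) - l ^+ 2 * quad_var g (q%:R ^+ j * x))) < a].
Proof.
move=> mg pg g0.
have mV : measurable_fun setT (quad_var g).
  apply: measurable_funD; first exact: measurable_funX.
  by apply: measurable_mulq; apply: measurable_transfer; exact: measurable_funX.
have mE : measurable_fun setT (exp_diff l g).
  apply: measurableT_comp => //; apply: measurable_funB; exact: measurable_scalel.
have pV : periodic1 (quad_var g).
  move=> x; rewrite /quad_var pg; congr (_ + _).
  by apply: (periodic1_mulq q (f := transfer q _)); apply: periodic1_transfer => y; rewrite pg.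
have pE : periodic1 (exp_diff l g) by move=> x; rewrite /exp_diff pg pV.
have E0 x : 0 <= exp_diff l g x by exact: expR_ge0.
exists (stopped a (exp_diff l g) n); split.
- exact: measurable_stopped.
- exact: periodic1_stopped.
- by move=> x; exact: stopped_ge0.
- by apply: int01_stopped => // x; exact: transfer_exp_diff.
- move=> x m mn; rewrite !ltNge; apply: contra.
  rewrite expR_sum; exact: stopped_reach.
Qed.

End Martingale.

(** * The exponential on the circle *)

Section ComplexExponential.
Variable R : realType.
Local Notation C := R[i].
Implicit Types (x y t : R) (b : C).
Local Notation pi := (@pi R).

Lemma eD x y : e (x + y) = e x * e y :> C.
Proof.
by rewrite /e mulrDr cosD sinD; apply/eqP; rewrite eq_complex /=;
  apply/andP; split; apply/eqP; ring.
Qed.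

Lemma e0 : e 0 = 1 :> C.
Proof. by rewrite /e mulr0 cos0 sin0. Qed.

Lemma eMn n x : e (n%:R * x) = e x ^+ n :> C.
Proof.
elim: n => [|n IH]; first by rewrite mul0r e0 expr0.
by rewrite -nat1r mulrDl mul1r eD IH exprS.
Qed.

Lemma e1 : e 1 = 1 :> C.
Proof. by rewrite /e mulr1 mulrC mulr_natr cos2pi sin2pi. Qed.

Lemma normc_e x : normc (e x) = 1.
Proof. by rewrite /normc /e /= cos2Dsin2 sqrtr1. Qed.

Lemma e_neq0 x : e x != 0 :> C.
Proof. by apply/eqP => h; have := normc_e x; rewrite h normc0 => /eqP; rewrite eq_sym oner_eq0. Qed.

Lemma normc_prod (I : Type) (s : seq I) (F : I -> C) :
  normc (\prod_(i <- s) F i) = \prod_(i <- s) normc (F i).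
Proof. by apply: big_morph; [exact: normcM | exact: normc1]. Qed.

Lemma normcX b n : normc (b ^+ n) = normc b ^+ n.
Proof. by elim: n => [|n IH]; rewrite ?normc1 // !exprS normcM IH. Qed.

Lemma normc_ge0 b : 0 <= normc b.
Proof. by case: b => a c; exact: sqrtr_ge0. Qed.

Lemma normc_gt0 b : b != 0 -> 0 < normc b.
Proof.
move=> b0; rewrite lt_def normc_ge0 andbT; apply: contra b0 => /eqP h.
by apply/eqP; exact: eq0_normc.
Qed.

Lemma normc_eB x y : normc (e x - e y) = 2 * `|sin (pi * (x - y))|.
Proof.
have -> : e x - e y = e y * (e (x - y) - 1).
  by rewrite mulrBr mulr1 -eD [y + _]addrC subrK.
rewrite normcM normc_e mul1r /e /= subr0; set t := x - y.
have -> : 2 * pi * t = (pi * t) *+ 2 by ring.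
rewrite cos_mulr2n sin_mulr2n; set c := cos _; set s := sin _.
have hc : c ^+ 2 = 1 - s ^+ 2 by rewrite /c cos2sin2.
have -> : (c ^+ 2 *+ 2 - 1 - 1) ^+ 2 + ((c * s) *+ 2) ^+ 2 = (2 * s) ^+ 2.
  have -> : ((c * s) *+ 2) ^+ 2 = 4 * c ^+ 2 * s ^+ 2 by ring.
  by rewrite hc; ring.
by rewrite sqrtr_sqr normrM ger0_norm.
Qed.

Lemma e_period x : e (x + 1) = e x :> C.
Proof. by rewrite eD e1 mulr1. Qed.

Lemma e_neq1 t : 0 < t < 1 -> e t != 1 :> C.
Proof.
move=> /andP[t0 t1]; apply/eqP => h.
have := normc_eB t 0; rewrite h e0 subrr normc0 subr0 => /eqP.
rewrite eq_sym mulf_eq0 pnatr_eq0 /= normr_eq0 gt_eqF // sin_gt0_pi //.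
by rewrite mulr_gt0 ?pi_gt0 //= gtr_pMr ?pi_gt0.
Qed.

(** This makes the [q]-th roots of unity available as the values [e(j / q)]. *)
Lemma e_prim_root q : (0 < q)%N -> q.-primitive_root (e q%:R^-1 : C).
Proof.
move=> q0; apply/andP; split => //; apply/forallP => i; rewrite unity_rootE -eMn.
have [->|iq] := eqVneq i.+1 q.
  by rewrite divff ?pnatr_eq0 -?lt0n // e1 eqxx.
have {}iq : (i.+1 < q)%N by rewrite ltn_neqAle iq ltn_ord.
apply/eqP/negbTE/e_neq1; rewrite divr_gt0 ?ltr0n //=.
by rewrite ltr_pdivrMr ?ltr0n // mul1r ltr_nat.
Qed.

(** The [e(y)], for [y] a preimage of [x], are the roots of [z^q = e(x)]. *)
Lemma prod_normc_preimages q x b : (0 < q)%N ->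
  \prod_(j < q) normc (e ((x + j%:R) / q%:R) - b) = normc (e x - b ^+ q).
Proof.
move=> q0; set z := e (x / q%:R) : C.
have zq : z ^+ q = e x by rewrite -eMn mulrC mulfVK // pnatr_eq0 -lt0n.
have z0 : z != 0 by exact: e_neq0.
have hr : ('X^q - 1 : {poly C}).[b / z] = (b / z) ^+ q - 1.
  by rewrite hornerD hornerXn hornerN (hornerC 1).
have h : \prod_(0 <= j < q) (b / z - e q%:R^-1 ^+ j) = (b / z) ^+ q - 1.
  rewrite -hr -(factor_Xn_sub_1 (e_prim_root q0)) horner_prod.
  by apply: eq_bigr => j _; rewrite hornerXsubC.
rewrite -zq.
have -> : z ^+ q - b ^+ q = - (z ^+ q * ((b / z) ^+ q - 1)).
  by rewrite expr_div_n mulrBr mulr1 mulrCA divff ?expf_neq0 // mulr1 opprB.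
rewrite -h normcN normcM normc_prod normcX normc_e expr1n mul1r big_mkord.
apply: eq_bigr => j _.
rewrite -eMn mulrDl eD -/z -[LHS]normcN opprB.
have -> : b - z * e (j%:R / q%:R) = z * (b / z - e (j%:R / q%:R)).
  by rewrite mulrBr mulrCA divff // mulr1.
by rewrite normcM normc_e mul1r.
Qed.

(** On [[0, 1/2]] even [s <= sin(pi s)] holds: either the cosine is at least [1/2]
there and the mean value theorem applies, or it is below [1/2] and the sine is
large.  The rest follows by the symmetry [s |-> 1 - s]. *)
Lemma sin_pi_ge t : 0 <= t <= 1 -> t * (1 - t) <= sin (pi * t).
Proof.
have half s : 0 <= s <= 2^-1 -> s <= sin (pi * s).
  move=> /andP[]; rewrite le_eqVlt => /predU1P[<- _|s0 s1]; first by rewrite mulr0 sin0.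
  have ps0 : 0 < pi * s by rewrite mulr_gt0 // pi_gt0.
  have pis : pi * s <= pi / 2 by rewrite ler_pM2l ?pi_gt0.
  have pi2 := @pi_ge2 R.
  have sin0' : 0 <= sin (pi * s) by apply: sin_ge0_pi; rewrite ltW //=; lra.
  have [c1|c1] := leP 2^-1 (cos (pi * s)); last first.
    have c0 : 0 <= cos (pi * s) by apply: cos_ge0_pihalf; rewrite pis andbT; lra.
    have := cos2Dsin2 (pi * s); nra.
  have [c cI] := @MVT R (@sin R) (@cos R) 0 (pi * s) ps0
     (fun x _ => is_derive_sin x)
     (continuous_subspaceT (@continuous_sin R)).
  rewrite sin0 !subr0 => ->.
  move: cI; rewrite in_itv /= => /andP[c0 cs].
  have : cos (pi * s) < cos c.
    by rewrite ltr_cos // in_itv /=; apply/andP; split; lra.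
  nra.
move=> /andP[t0 t1]; have [h|h] := leP t 2^-1.
  by apply: le_trans (half t _); rewrite ?t0 //; nra.
have -> : sin (pi * t) = sin (pi * (1 - t)).
  have -> : pi * (1 - t) = - (pi * t) + pi by ring.
  by rewrite sinDpi sinN opprK.
by apply: le_trans (half (1 - t) _); [nra | lra].
Qed.

Definition dist_e b (x : R) : R := normc (e x - b).

Lemma continuous_dist_e b : continuous (dist_e b).
Proof.
case: b => b1 b2.
have -> : dist_e (Complex b1 b2) = (@Num.sqrt R) \o (fun x => (cos (2 * pi * x) - b1) ^+ 2 + (sin (2 * pi * x) - b2) ^+ 2).
  by [].
have c1 : continuous (fun x : R => 2 * pi * x) by move=> x; apply: mulrl_continuous.
have cc : continuous (fun x : R => cos (2 * pi * x) - b1).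
  move=> x; apply: cvgB; last exact: cvg_cst.
  by apply: (@continuous_comp _ _ _ (fun x => 2 * pi * x) (@cos R)); [exact: c1 | exact: continuous_cos].
have cs : continuous (fun x : R => sin (2 * pi * x) - b2).
  move=> x; apply: cvgB; last exact: cvg_cst.
  by apply: (@continuous_comp _ _ _ (fun x => 2 * pi * x) (@sin R)); [exact: c1 | exact: continuous_sin].
move=> x; apply: continuous_comp; last exact: sqrt_continuous.
apply: (@cvgD _ R^o).
  by apply: (@cvg_comp _ _ _ (fun x : R => cos (2 * pi * x) - b1) (fun y : R => y ^+ 2)); [exact: cc | exact: exprn_continuous].
by apply: (@cvg_comp _ _ _ (fun x : R => sin (2 * pi * x) - b2) (fun y : R => y ^+ 2)); [exact: cs | exact: exprn_continuous].
Qed.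

Lemma measurable_dist_e b : measurable_fun setT (dist_e b).
Proof. apply: continuous_measurable_fun; exact: continuous_dist_e. Qed.

(** With [e(x0)] a point of the circle closest to [b], the triangle inequality gives
[|e(x) - e(x0)| <= 2 |e(x) - b|].  This makes the singularity of
[ln |e(x) - b|] comparable to that at a point of the circle, uniformly in [b]. *)
Lemma dist_e_ge b : exists2 x0 : R, 0 <= x0 <= 1 &
  forall x, 0 <= x <= 1 -> `|x - x0| * (1 - `|x - x0|) <= dist_e b x.
Proof.
have [x0 x0I min0] := @EVT_min R (dist_e b) 0 1 ler01
  (continuous_subspaceT (@continuous_dist_e b)).
move: x0I; rewrite in_itv /= => x0I.
exists x0 => // x xI.
have tI : 0 <= `|x - x0| <= 1.
  rewrite normr_ge0 ler_norml; lra.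
apply: le_trans (sin_pi_ge tI) _.
have -> : sin (pi * `|x - x0|) = `|sin (pi * (x - x0))|.
  have [h|h] := leP 0 (x - x0).
    rewrite ger0_norm // ger0_norm // sin_ge0_pi // mulr_ge0 ?pi_ge0 //=.
    by rewrite ger_pMr ?pi_gt0 //; move: tI; rewrite ger0_norm // => /andP[].
  rewrite ltr0_norm // mulrN sinN -normrN ger0_norm // -sinN -mulrN sin_ge0_pi //.
  move: tI; rewrite ltr0_norm // => /andP[h1 h2].
  by rewrite mulr_ge0 ?pi_ge0 //= ger_pMr ?pi_gt0.
rewrite -(@ler_pM2l _ 2) // -normc_eB.
have -> : e x - e x0 = (e x - b) + (b - e x0) by rewrite addrA subrK.
apply: le_trans (le_normcD _ _) _.
rewrite -[X in _ + X <= _]normcN opprB.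
have := min0 x; rewrite in_itv /= => /(_ xI); rewrite /dist_e; lra.
Qed.

End ComplexExponential.

(** * Borel-Cantelli and the potentials ln |e(x) - b| *)

Section BorelCantelli.
Variable R : realType.
Local Notation mu := (@lebesgue_measure R).

Lemma int01_markov (A : set R) (f : R -> R) : measurable A -> measurable_fun setT f ->
  (forall x, 0 <= f x) -> (forall x, A x -> 1 <= f x) ->
  (mu (A `&` `[0%R, 1%R[) <= int01 f)%E.
Proof.
move=> mA mf f0 f1; rewrite -integral_indic //.
apply: ge0_le_integral => //.
- by apply: measurable_EFinS; exact: measurable_indic.
- exact: measurable_EFinS.
- move=> x _; rewrite lee_fin indicE; case: (boolP (x \in A)) => [xA|_] /=.
    by apply: f1; exact: set_mem.
  exact: f0.
Qed.

(** The bad events are encoded by functions [W k] that are at least one on them, so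
that no measurability of events has to be discussed. *)
Lemma borel_cantelli_int01 (W : nat -> R -> R) (c : nat -> R) (M : R) :
  (forall k, measurable_fun setT (W k)) -> (forall k x, 0 <= W k x) ->
  (forall k, (int01 (W k) <= (c k)%:E)%E) ->
  (forall n, \sum_(k < n) c k <= M) ->
  {ae mu, forall x, 0 <= x < 1 -> exists k0 : nat, forall k, (k0 <= k)%N -> W k x < 1}.
Proof.
move=> mW W0 Wc cM.
pose F k := [set x : R | 1 <= W k x] `&` `[0%R, 1%R[.
have mA k : measurable [set x : R | 1 <= W k x].
  by rewrite -[X in measurable X]setTI; apply: measurable_fun_le.
have mF k : measurable (F k) by apply: measurableI.
have F0 : mu (lim_sup_set F) = 0%E.
  apply: lim_sup_set_cvg0 => //.
  apply: (@le_lt_trans _ _ M%:E); last exact: ltry.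
  apply: lime_le; first exact: is_cvg_nneseries.
  apply: nearW => n; rewrite big_mkord.
  apply: (@le_trans _ _ (\sum_(k < n) (c k)%:E)%E).
    by apply: lee_sum => k _; apply: le_trans (Wc k); exact: int01_markov.
  by rewrite sumEFin lee_fin.
exists (lim_sup_set F); split => //.
  by apply: bigcap_measurable => // k _; by apply: bigcup_measurable => j _; exact: mF.
move=> x /= /not_implyP[xI nk] n _.
have : ~ forall k, (n <= k)%N -> W k x < 1 by move=> h; apply: nk; exists n.
move=> /existsNP[k /not_implyP[nk' /negP]]; rewrite -leNgt => h.
by exists k => //; split => //=; rewrite in_itv.
Qed.

Lemma sum_geo_le (r : R) n : 0 <= r < 1 -> \sum_(k < n) r ^+ k <= (1 - r)^-1.
Proof.
move=> /andP[r0 r1]; rewrite -[X in _ <= X]mul1r ler_pdivlMr ?subr_gt0 //.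
have -> : (\sum_(k < n) r ^+ k) * (1 - r) = 1 - r ^+ n.
  by rewrite mulrC -opprB mulNr -subrX1 opprB.
by rewrite gerBl exprn_ge0.
Qed.
End BorelCantelli.

Section Potential.
Variable R : realType.
Local Notation mu := (@lebesgue_measure R).
Local Notation C := R[i].
Implicit Types (x : R) (b : C).

(** At the points with [e x = b] the value is [0], by the convention [ln 0 = 0]; the
identities below therefore exclude such points, which form a null set. *)
Definition lnd b x : R := ln (dist_e b x).
(** The constant [2 ln 2] makes this function at least [ln 2] on the circle when
[|b| <= 1], so that it is positive and dominates [|ln |e(x) - b||]. *)
Definition pot b x : R := 2 * ln 2 - lnd b x.

Lemma periodic1_lnd b : periodic1 (lnd b).
Proof. by move=> x; rewrite /lnd /dist_e e_period. Qed.

Lemma periodic1_pot b : periodic1 (pot b).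
Proof. by move=> x; rewrite /pot periodic1_lnd. Qed.

Lemma measurable_lnd b : measurable_fun setT (lnd b).
Proof. by apply: (measurableT_comp (@measurable_ln R)); exact: measurable_dist_e. Qed.

Lemma measurable_pot b : measurable_fun setT (pot b).
Proof. by apply: measurable_funB => //; exact: measurable_lnd. Qed.

Lemma ln2_gt0 : 0 < ln 2 :> R.
Proof. by rewrite ln_gt0 ?ltr1n. Qed.

Lemma lnd_le b x : normc b <= 1 -> lnd b x <= ln 2.
Proof.
move=> b1; rewrite /lnd; have [h|h] := leP (dist_e b x) 0.
  by rewrite ln0 // ltW // ln2_gt0.
rewrite ler_ln ?posrE //; apply: le_trans (le_normcD _ _) _.
by rewrite normcN normc_e; lra.
Qed.

Lemma pot_ge b x : normc b <= 1 -> ln 2 <= pot b x.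
Proof. by move=> b1; have := lnd_le x b1; rewrite /pot; lra. Qed.

Lemma pot_ge0 b x : normc b <= 1 -> 0 <= pot b x.
Proof. by move=> b1; apply: le_trans (pot_ge x b1); rewrite ltW // ln2_gt0. Qed.

Lemma norm_lnd_le b x : normc b <= 1 -> `|lnd b x| <= pot b x.
Proof.
move=> b1; have := lnd_le x b1; have := ln2_gt0.
by rewrite ler_norml /pot => h1 h2; lra.
Qed.

(** The basic identity: it says that [lnd b] is mapped by the transfer operator to a
multiple [1 / q] of a function of the same family. *)
Lemma sum_lnd_preimages q b x : (0 < q)%N -> e x != b ^+ q ->
  \sum_(j < q) lnd b ((x + j%:R) / q%:R) = lnd (b ^+ q) x.
Proof.
move=> q0 xb; rewrite {2}/lnd /dist_e -prod_normc_preimages //.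
have : \prod_(j < q) normc (e ((x + j%:R) / q%:R) - b) != 0.
  by rewrite prod_normc_preimages // gt_eqF // normc_gt0 // subr_eq0.
move=> /prodf_neq0 nz.
have pos j : 0 < normc (e ((x + (j : 'I_q)%:R) / q%:R) - b).
  by rewrite lt_def normc_ge0 nz.
rewrite -[LHS]expRK expR_sum; congr ln; apply: eq_bigr => j _.
by rewrite /lnd /dist_e lnK // posrE.
Qed.

Lemma transfer_lnd q b x : (0 < q)%N -> e x != b ^+ q ->
  transfer q (lnd b) x = q%:R^-1 * lnd (b ^+ q) x.
Proof. by move=> q0 xb; rewrite /transfer sum_lnd_preimages. Qed.

Lemma sum_pot_preimages q b x : (0 < q)%N -> e x != b ^+ q ->
  \sum_(j < q) pot b ((x + j%:R) / q%:R) = pot (b ^+ q) x + (q%:R - 1) * (2 * ln 2).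
Proof.
move=> q0 xb; rewrite /pot sumrB sum_lnd_preimages // sumr_const card_ord.
rewrite -[_ *+ q]mulr_natl; ring.
Qed.

(** This crude inequality is sharp enough here: at most one of the preimages of [x]
can be close to [b], so a single term dominates. *)
Lemma sum_sqr_le (n : nat) (s : 'I_n -> R) : (forall j, 0 <= s j) ->
  \sum_j s j ^+ 2 <= (\sum_j s j) ^+ 2.
Proof.
move=> s0; rewrite expr2 mulr_suml; apply: ler_sum => j _.
rewrite expr2 ler_wpM2l // (bigD1 j) //= lerDl sumr_ge0 //.
Qed.

Lemma transfer_pot_sqr q b x : (0 < q)%N -> normc b <= 1 -> e x != b ^+ q ->
  transfer q (fun y => pot b y ^+ 2) x <=
  q%:R^-1 * (pot (b ^+ q) x + (q%:R - 1) * (2 * ln 2)) ^+ 2.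
Proof.
move=> q0 b1 xb; rewrite /transfer ler_wpM2l ?invr_ge0 // -sum_pot_preimages //.
by apply: sum_sqr_le => j; exact: pot_ge0.
Qed.

Lemma normcX_le1 b n : normc b <= 1 -> normc (b ^+ n) <= 1.
Proof. by move=> b1; rewrite normcX exprn_ile1 // normc_ge0. Qed.

(** The factor [3 / 4 < 1], uniform in [b] and [q], comes from [1 / q <= 1 / 2] and
[(u + c)^2 <= (3/2) u^2 + 3 c^2]. *)
Lemma transfer_pot_sqr_drift q b x : (1 < q)%N -> normc b <= 1 -> e x != b ^+ q ->
  transfer q (fun y => pot b y ^+ 2) x <=
  3 / 4 * pot (b ^+ q) x ^+ 2 + 3 / 2 * ((q%:R - 1) * (2 * ln 2)) ^+ 2.
Proof.
move=> q1 b1 xb; apply: le_trans (transfer_pot_sqr (ltnW q1) b1 xb) _.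
set c := _ * (2 * _); set u := pot _ _.
have h : q%:R^-1 <= 2^-1 :> R by rewrite lef_pV2 ?posrE ?ltr0n ?(ltnW q1) // ler_nat.
apply: (@le_trans _ _ (2^-1 * (u + c) ^+ 2)); first by rewrite ler_wpM2r // sqr_ge0.
by have := sqr_ge0 (u - 2 * c); rewrite !expr2; lra.
Qed.

Lemma transfer_pot_sqr_le q b x : (0 < q)%N -> normc b <= 1 -> e x != b ^+ q ->
  transfer q (fun y => pot b y ^+ 2) x <= 4 * q%:R * pot (b ^+ q) x ^+ 2.
Proof.
move=> q0 b1 xb; apply: le_trans (transfer_pot_sqr q0 b1 xb) _.
have := pot_ge x (normcX_le1 q b1); set u := pot _ _ => hu.
have l2 := ln2_gt0.
have q1 : 1 <= q%:R :> R by rewrite ler1n.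
rewrite ler_pdivrMl ?ltr0n //.
have -> : q%:R * (4 * q%:R * u ^+ 2) = (2 * q%:R * u) ^+ 2 by ring.
rewrite ler_sqr ?nnegrE; last 2 first.
- have : 0 <= (q%:R - 1) * (2 * ln 2) :> R by apply: mulr_ge0; lra.
  by lra.
- by apply: mulr_ge0; lra.
have : (q%:R - 1) * (2 * ln 2) <= (q%:R - 1) * (2 * u) by rewrite ler_wpM2l ?subr_ge0 // ler_pM2l.
lra.
Qed.

(** By [dist_e_ge] the set is contained in a neighbourhood of [x0] modulo [1], which
is covered by three intervals of [R]. *)
Lemma measure_pot_ge b (n : R) :
  (mu ([set x | (n <= pot b x)%R] `&` `[0%R, 1%R[) <= (32 * expR (- n))%:E)%E.
Proof.
have [x0 x0I hx0] := dist_e_ge b.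
set s := 8 * expR (- n).
have s0 : 0 < s by rewrite mulr_gt0 // expR_gt0.
(* Here [t (1 - t) <= s / 2] for [t = |x - x0|], so [t <= s] or [1 - t <= s]; in the
   second case [x] is near an endpoint of [[0, 1]]. *)
have sub : [set x | n <= pot b x] `&` `[0%R, 1%R[ `<=`
    `[x0 - s, x0 + s]%classic `|` (`[0, s]%classic `|` `[1 - s, 1]%classic).
  move=> x [/= xn]; rewrite in_itv /= => /andP[xge xlt].
  have dle : dist_e b x <= 4 * expR (- n).
    have [h|h] := leP (dist_e b x) 0.
      by apply: le_trans h _; rewrite mulr_ge0 // expR_ge0.
    have : lnd b x <= 2 * ln 2 - n by move: xn; rewrite /pot; lra.
    rewrite -ler_expR /lnd lnK ?posrE // expRD => h'; apply: le_trans h' _.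
    rewrite (_ : 2 * ln 2 = ln 2 + ln 2); last by ring.
    by rewrite expRD lnK ?posrE //; lra.
  have := hx0 x; rewrite xge ltW // => /(_ isT) => ht.
  have {}ht : `|x - x0| * (1 - `|x - x0|) <= s / 2.
    by apply: le_trans ht _; apply: le_trans dle _; rewrite /s; lra.
  move: x0I => /andP[x00 x01].
  have tp := normr_ge0 (x - x0).
  have t1 : `|x - x0| <= 1 by rewrite ler_norml; lra.
  rewrite /= !in_itv /=.
  have [t2|t2] := leP `|x - x0| (2^-1).
    left; have : `|x - x0| <= s.
      have : 0 <= `|x - x0| * (2^-1 - `|x - x0|) by rewrite mulr_ge0 // subr_ge0.
      move: ht; rewrite !mulrBr !mulr1; lra.
    by rewrite ler_norml; lra.
  have : 1 - `|x - x0| <= s.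
    have : 0 <= (1 - `|x - x0|) * (`|x - x0| - 2^-1) by rewrite mulr_ge0 // subr_ge0 // ltW.
    move: ht; rewrite !mulrBr !mulrBl !mulr1 !mul1r; lra.
  have [h|h] := leP 0 (x - x0).
    by rewrite ger0_norm // => ?; right; right; lra.
  by rewrite ltr0_norm // => ?; right; left; lra.
have mI (a c : R) : measurable (`[a, c]%classic : set R) by [].
apply: (@le_trans _ _ (mu (`[x0 - s, x0 + s]%classic `|` (`[0, s]%classic `|` `[1 - s, 1]%classic)))).
  apply: le_measure => //; rewrite inE.
    apply: measurableI => //.
    rewrite -[X in measurable X]setTI; apply: measurable_fun_le => //.
    exact: measurable_pot.
  by apply: measurableU => //; exact: measurableU.
have U2 (A B : set R) : measurable A -> measurable B -> (mu (A `|` B) <= mu A + mu B)%E.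
  by move=> mA mB; exact: measureU2.
apply: (le_trans (U2 _ _ _ _)) => //; first exact: measurableU.
have len (a d : R) : 0 <= d -> mu `[a, a + d]%classic = d%:E.
  move=> d0; rewrite lebesgue_measure_itv /= lte_fin; case: ltP.
    by move=> _; rewrite -EFinD addrAC subrr add0r.
  by move=> ?; congr EFin; lra.
apply: (@le_trans _ _ ((2 * s)%:E + (s%:E + s%:E))%E).
  apply: leeD; last (apply: (le_trans (U2 _ _ _ _)) => //; apply: leeD).
  - rewrite (_ : x0 + s = (x0 - s) + 2 * s); last by ring.
    by rewrite len //; lra.
  - by rewrite -{1}[s]add0r len // ltW.
  - by rewrite -{2}[1](subrK s) len // ltW.
by rewrite -!EFinD lee_fin /s; lra.
Qed.

(** Summing over the integer part of the potential, the polynomial weights are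
absorbed by half of the exponential decay of [measure_pot_ge]. *)
Lemma int01_pot4 : exists2 K : R, 0 <= K &
  forall b, normc b <= 1 -> (int01 (fun x => pot b x ^+ 4)%R <= K%:E)%E.
Proof.
set r := expR (- 2^-1) : R.
have r01 : 0 <= r < 1 by rewrite expR_ge0 /= expR_lt1 //; lra.
exists (32 * 10 ^+ 5 * (1 - r)^-1).
  by rewrite !mulr_ge0 ?invr_ge0 ?exprn_ge0 // subr_ge0; case/andP: r01 => _ /ltW.
move=> b b1.
pose A n := [set x : R | n%:R <= pot b x].
have mA n : measurable (A n).
  by rewrite -[X in measurable X]setTI; apply: measurable_fun_le => //; exact: measurable_pot.
(* The sum of the [G n] dominates the fourth power: the term indexed by the integer
   part of the potential already does. *)
pose G n x : \bar R := ((n%:R + 1) ^+ 4 * \1_(A n) x)%:E.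
have mG n : measurable_fun (`[0%R, 1%R[%classic : set R) (G n).
  by apply: measurable_EFinS; apply: measurable_funM => //; exact: measurable_indic.
have G0 n x : (0 <= G n x)%E by rewrite lee_fin mulr_ge0 // ?exprn_ge0 // ?addr_ge0.
apply: (@le_trans _ _ (\int[mu]_(x in `[0%R, 1%R[) (\sum_(n <oo) G n x)%E)%E).
  apply: ge0_le_integral => //.
  - by move=> x _; rewrite lee_fin; apply: exprn_ge0; exact: pot_ge0.
  - by apply: measurable_EFinS; apply: measurable_funX; exact: measurable_pot.
  - apply: ge0_emeasurable_sum => *; [exact: G0 | exact: mG].
  - move=> x _; have u0 := pot_ge0 x b1.
    have /andP[h1 h2] := truncn_itv u0; set N := Num.truncn _ in h1 h2.
    apply: (@le_trans _ _ (\sum_(0 <= n < N.+1) G n x)%E); last exact: nneseries_lim_ge.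
    rewrite big_nat_recr //=.
    apply: (@le_trans _ _ (G N x)); last by rewrite leeDr // sume_ge0.
    rewrite /G lee_fin indicE mem_set // mulr1.
    have N0 : 0 <= N%:R + 1 :> R by rewrite addr_ge0.
    by rewrite ler_pXn2r ?nnegrE // natr1 ltW.
apply: (@le_trans _ _ (\sum_(n <oo) \int[mu]_(x in `[0%R, 1%R[) G n x)%E).
  by rewrite le_eqVlt; apply/orP; left; apply/eqP; apply: integral_nneseries.
apply: lime_le; first by apply: is_cvg_nneseries => n _ _; apply: integral_ge0.
apply: nearW => n; rewrite big_mkord.
apply: (@le_trans _ _ (\sum_(k < n) (32 * 10 ^+ 5 * r ^+ k)%:E)%E); last first.
  rewrite sumEFin lee_fin -mulr_sumr ler_wpM2l ?mulr_ge0 ?exprn_ge0 //.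
  exact: sum_geo_le.
apply: lee_sum => k _.
rewrite /G; under eq_integral do rewrite EFinM.
rewrite ge0_integralZl_EFin //; last by apply: measurable_EFinS; exact: measurable_indic.
rewrite integral_indic //.
apply: (@le_trans _ _ (((k%:R + 1) ^+ 4)%:E * (32 * expR (- k%:R))%:E)%E).
  by apply: lee_wpmul2l; [rewrite lee_fin exprn_ge0 // addr_ge0 | exact: measure_pot_ge].
rewrite -EFinM lee_fin.
have e10 : 1 + k%:R / 10 <= expR (k%:R / 10) :> R by exact: expR_ge1Dx.
have k0 : 0 <= k%:R :> R by [].
have h5 : (1 + k%:R / 10) ^+ 5 <= expR (k%:R / 2) :> R.
  rewrite (_ : k%:R / 2 = 5%:R * (k%:R / 10) :> R); last by field.
  rewrite expRM_natl lerXn2r ?nnegrE ?expR_ge0 // ; lra.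
have h4 : (k%:R + 1) ^+ 4 <= 10 ^+ 5 * expR (k%:R / 2) :> R.
  apply: (@le_trans _ _ (10 ^+ 5 * (1 + k%:R / 10) ^+ 5)); last by rewrite ler_pM2l.
  rewrite -exprMn mulrDr mulr1 mulrCA divff // mulr1.
  apply: (@le_trans _ _ ((10 + k%:R) ^+ 4)).
    by rewrite lerXn2r ?nnegrE //; lra.
  by rewrite [X in _ <= X]exprS ler_peMl ?exprn_ge0 //; lra.
have rk : r ^+ k = expR (k%:R / 2) * expR (- k%:R).
  by rewrite /r -expRM_natl -expRD; congr expR; field.
rewrite rk.
have ep := expR_ge0 (- k%:R : R).
have -> : 32 * 10 ^+ 5 * (expR (k%:R / 2) * expR (- k%:R)) =
   (10 ^+ 5 * expR (k%:R / 2)) * (32 * expR (- k%:R)) :> R by ring.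
by rewrite ler_wpM2r // mulr_ge0.
exact: mA.
Qed.

End Potential.

(** * The deterministic part of the multilevel estimate *)

Section MultilevelBound.
Variable R : realType.

Lemma expR_half_le2 : expR 2^-1 <= 2 :> R.
Proof.
have h : 2^-1 <= expR (- 2^-1) :> R by apply: le_trans (expR_ge1Dx _); lra.
have h2 : expR 2^-1 * expR (- 2^-1) = 1 :> R by rewrite -expRD subrr expR0.
have := expR_gt0 (2^-1 : R); nra.
Qed.

Lemma ln_ge1 (x : R) : 4 <= x -> 1 <= ln x.
Proof.
move=> x4; rewrite -ler_expR lnK ?posrE; last by lra.
apply: le_trans x4.
have -> : expR 1 = expR 2^-1 ^+ 2 :> R by rewrite -expRM_natl; congr expR; field.
have := expR_gt0 (2^-1 : R); have := expR_half_le2; nra.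
Qed.

(** The real-number content of the iterated logarithm at the scale [n = 2^k], for the
arrays [f i j], [U i j], ... of the values at [q^(i+j) x] of the functions of
level [i].  The drift inequality bounds the sums of [U^2], hence those of [V],
by a multiple of [n] at the levels up to [2k]; the exponential inequalities then
bound the sums of [g] by a multiple of [sqrt(n ln k)], and the relation between
consecutive levels sums these with weights [q^(-i)].  Levels up to [3k] are used
for the drift so that the remainder has the factor [(3/4)^k], and levels up to
[2k] for [f] so that [q^(-2k)] beats the trivial bound, of order [n], of the
last one. *)
Lemma multilevel_bound (q k : nat) (C0 : R) (U f g m V : nat -> nat -> R) :
  (2 <= q)%N -> (4 <= k)%N -> 0 <= C0 ->
  let n := (2 ^ k)%N in
  let l := Num.sqrt (ln k%:R / n%:R) in
  let K1 := 4 * (1 + C0) + 1 in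
  let K2 := (4 * q%:R + 3) * K1 in
  (forall i j, f i j = g i j + q%:R^-1 * f i.+1 j) ->
  (forall i j, U i j ^+ 2 <= m i j + C0 + 3 / 4 * U i.+1 j ^+ 2) ->
  (forall i j, 0 <= V i j <= 2 * U i j ^+ 2 + (4 * q%:R + 1) * U i.+1 j ^+ 2) ->
  (forall i j, `|f i j| <= U i j) ->
  (forall i N, (i < k.*2)%N -> (N <= n)%N -> forall s : bool,
     \sum_(N <= j < n) ((-1) ^+ s * l * g i j - l ^+ 2 * V i j) <= 3 * ln (k.+1)%:R) ->
  (forall i, (i < 3 * k)%N -> \sum_(0 <= j < n) m i j <= n%:R) ->
  (3 / 4) ^+ k * (\sum_(0 <= j < n) U (3 * k)%N j ^+ 2) <= n%:R ->
  forall N, (N <= n)%N ->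
  `|\sum_(0 <= j < N) f 0%N j| <= (4 * (6 + K2) + 1 + K1) * Num.sqrt (n%:R * ln k%:R).
Proof.
move=> q2 k4 C00 n l K1 K2 R1 R2 R3 R4 H1 H2 H3 N Nn.
have n0 : 0 < n%:R :> R by rewrite ltr0n expn_gt0.
have K1p : 1 <= K1 by rewrite /K1; lra.
have q2R : 2 <= q%:R :> R by rewrite ler_nat.
have K2p : 0 <= K2 by rewrite /K2 mulr_ge0 //; lra.
have lnk1 : 1 <= ln k%:R :> R by apply: ln_ge1; rewrite ler_nat.
have lnk0 : 0 <= ln k%:R :> R by lra.
have kpos : 0 < k%:R :> R by rewrite ltr0n (leq_trans _ k4).
set L := Num.sqrt (n%:R * ln k%:R).
have L1 : 1 <= L.
  have h : 1 <= n%:R :> R by rewrite ler1n expn_gt0.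
  have h2 : 1 * 1 <= n%:R * ln k%:R :> R by apply: ler_pM.
  by rewrite mulr1 in h2; rewrite -sqrtr1; exact: ler_wsqrtr.
have l0 : 0 < l by rewrite sqrtr_gt0 divr_gt0 //; lra.
have lL : l * L = ln k%:R.
  have h0 : 0 <= ln k%:R / n%:R :> R by rewrite divr_ge0.
  rewrite -sqrtrM // mulrA mulfVK ?gt_eqF // -expr2 sqrtr_sqr ger0_norm //.
have nl2 : n%:R * l ^+ 2 = ln k%:R.
  by rewrite sqr_sqrtr ?divr_ge0 // mulrC mulfVK // gt_eqF.
have lnkS : ln k.+1%:R <= 2 * ln k%:R :> R.
  have -> : 2 * ln k%:R = ln (k%:R * k%:R) :> R by rewrite lnM ?posrE //; ring.
  rewrite ler_ln ?posrE ?mulr_gt0 // -natrM ler_nat.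
  by rewrite (leq_trans (n := (2 * k)%N)) // ?leq_mul2r ?(leq_trans _ k4) ?orbT // mul2n -addnn -addn1 leq_add2l (leq_trans _ k4).
pose S i := \sum_(0 <= j < n) U i j ^+ 2.
have S0 i : 0 <= S i by apply: sumr_ge0 => j _; exact: sqr_ge0.
have Sstep i : (i < 3 * k)%N -> S i <= n%:R * (1 + C0) + 3 / 4 * S i.+1.
  move=> ik; have hm := H2 i ik.
  apply: (@le_trans _ _ (\sum_(0 <= j < n) (m i j + C0 + 3 / 4 * U i.+1 j ^+ 2))).
    by apply: ler_sum => j _; exact: R2.
  rewrite !big_split /= -mulr_sumr sumr_const_nat subn0 -mulr_natl -/(S i.+1).
  lra.
have Sd d : (d <= 3 * k)%N -> S (3 * k - d)%N <= 4 * (n%:R * (1 + C0)) + (3 / 4) ^+ d * S (3 * k)%N.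
  elim: d => [|d IH] dk.
    by rewrite subn0 expr0 mul1r lerDr !mulr_ge0 //; lra.
  have := IH (ltnW dk); have := Sstep (3 * k - d.+1)%N.
  rewrite -subSn // subSS => h1 h2.
  rewrite exprS.
  have := h1 (leq_subr _ _); lra.
have Sbd i : (i <= k.*2)%N -> S i <= K1 * n%:R.
  move=> ik; have ik3 : (i <= 3 * k)%N by rewrite (leq_trans ik) // -mul2n leq_mul2r orbT.
  (* The level [i <= 2k] is at least [k] steps below the level [3k]. *)
  have := Sd (3 * k - i)%N (leq_subr _ _); rewrite subKn // => h.
  apply: (le_trans h).
  have : (3 / 4) ^+ (3 * k - i) * S (3 * k)%N <= (3 / 4) ^+ k * S (3 * k)%N.
    rewrite ler_wpM2r // ler_wiXn2l //; try lra.
    by clear -ik; lia.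
  move=> /le_trans /(_ H3); rewrite /K1; lra.
have Vbd i : (i < k.*2)%N -> \sum_(0 <= j < n) V i j <= K2 * n%:R.
  move=> ik.
  apply: (@le_trans _ _ (2 * S i + (4 * q%:R + 1) * S i.+1)).
    rewrite /S !mulr_sumr -big_split /=; apply: ler_sum => j _.
    by have /andP[] := R3 i j.
  have := Sbd i (ltnW ik); have := Sbd i.+1 ik => h1 h2.
  have : (4 * q%:R + 1) * S i.+1 <= (4 * q%:R + 1) * (K1 * n%:R) by rewrite ler_wpM2l //; lra.
  rewrite /K2; lra.
(* The maximal inequality controls the sums over tails [M <= j < n]; initial sums
   are differences of two of them. *)
have Gtail i M : (i < k.*2)%N -> (M <= n)%N -> `|\sum_(M <= j < n) g i j| <= (6 + K2) * L.
  move=> ik Mn.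
  have Vt : \sum_(M <= j < n) V i j <= K2 * n%:R.
    apply: le_trans (Vbd i ik); rewrite (big_cat_nat (leq0n M) Mn) /= lerDr.
    by apply: sumr_ge0 => j _; have /andP[] := R3 i j.
  have key (s : bool) : (-1) ^+ s * (\sum_(M <= j < n) g i j) <= (6 + K2) * L.
    have := H1 i M ik Mn s; rewrite sumrB -!mulr_sumr => h.
    rewrite -(ler_pM2l l0).
    have -> : l * ((6 + K2) * L) = (6 + K2) * ln k%:R by rewrite -lL; ring.
    have : l ^+ 2 * \sum_(M <= j < n) V i j <= l ^+ 2 * (K2 * n%:R).
      by rewrite ler_wpM2l // sqr_ge0.
    have -> : l ^+ 2 * (K2 * n%:R) = K2 * ln k%:R by rewrite -nl2; ring.
    rewrite [(-1) ^+ s * l]mulrC -mulrA in h.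
    lra.
  rewrite ler_norml; have := key false; have := key true.
  rewrite expr0 expr1; lra.
have G i M : (i < k.*2)%N -> (M <= n)%N -> `|\sum_(0 <= j < M) g i j| <= 2 * (6 + K2) * L.
  move=> ik Mn; have h1 := Gtail i 0%N ik (leq0n _); have h2 := Gtail i M ik Mn.
  have : \sum_(0 <= j < n) g i j = \sum_(0 <= j < M) g i j + \sum_(M <= j < n) g i j.
    by rewrite (big_cat_nat (leq0n M) Mn).
  move=> hs; have -> : \sum_(0 <= j < M) g i j = \sum_(0 <= j < n) g i j - \sum_(M <= j < n) g i j.
    by rewrite hs addrK.
  by apply: le_trans (ler_normB _ _) _; lra.
have Fd d : (d <= k.*2)%N ->
    `|\sum_(0 <= j < N) f 0%N j| <= (1 - 2^-1 ^+ d) * (4 * (6 + K2) * L) + 2^-1 ^+ d * `|\sum_(0 <= j < N) f d j|.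
  elim: d => [|d IH] dk; first by rewrite expr0 subrr mul0r mul1r add0r.
  apply: le_trans (IH (ltnW dk)) _.
  have : `|\sum_(0 <= j < N) f d j| <= 2 * (6 + K2) * L + 2^-1 * `|\sum_(0 <= j < N) f d.+1 j|.
    rewrite (eq_bigr (fun j => g d j + q%:R^-1 * f d.+1 j)) => [|j _]; last exact: R1.
    rewrite big_split /= -mulr_sumr; apply: le_trans (ler_normD _ _) _.
    apply: lerD; first exact: G.
    rewrite normrM ger0_norm ?invr_ge0 // ler_wpM2r //.
    by rewrite lef_pV2 ?posrE //; lra.
  set A := `| _ |; set B := `| _ |.
  move=> h; have p0 : 0 <= 2^-1 ^+ d :> R by rewrite exprn_ge0.
  have := ler_wpM2l p0 h; rewrite exprS; lra.
have := Fd k.*2 (leqnn _).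
have : `|\sum_(0 <= j < N) f k.*2 j| <= (1 + K1) * n%:R.
  apply: (@le_trans _ _ (\sum_(0 <= j < N) (1 + U k.*2 j ^+ 2))).
    apply: le_trans (ler_norm_sum _ _ _) _; apply: ler_sum => j _.
    apply: le_trans (R4 _ _) _; have := sqr_ge0 (U k.*2 j - 1); have := sqr_ge0 (U k.*2 j); rewrite !expr2; lra.
  apply: (@le_trans _ _ (\sum_(0 <= j < n) (1 + U k.*2 j ^+ 2))).
    rewrite [X in _ <= X](big_cat_nat (leq0n N) Nn) /= lerDl.
    by apply: sumr_ge0 => j _; rewrite addr_ge0 // sqr_ge0.
  rewrite big_split /= sumr_const_nat subn0 -/(S k.*2).
  have := Sbd k.*2 (leqnn _); lra.
set A := `| _ |; set B := `| _ |.
have -> : 2^-1 ^+ k.*2 = (n%:R * n%:R)^-1 :> R.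
  by rewrite exprVn -natrM -expnD addnn natrX.
move=> hA hB; apply: (le_trans hB).
have n1 : 1 <= n%:R :> R by rewrite ler1n expn_gt0.
have h1 : (n%:R * n%:R)^-1 * A <= 1 + K1.
  rewrite ler_pdivrMl ?mulr_gt0 //; apply: le_trans hA _.
  rewrite mulrC ler_wpM2r //; first lra.
  by rewrite -[X in X <= _]mulr1 ler_pM2l.
have h2 : (1 - (n%:R * n%:R)^-1) * (4 * (6 + K2) * L) <= 4 * (6 + K2) * L.
  have p1 : 0 <= (n%:R * n%:R)^-1 :> R by rewrite invr_ge0 mulr_ge0 // ltW.
  have p2 : 0 <= 4 * (6 + K2) * L by rewrite mulr_ge0 //; lra.
  by have := mulr_ge0 p1 p2; lra.
have : (1 + K1) * 1 <= (1 + K1) * L by rewrite ler_pM2l //; lra.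
by lra.
Qed.
End MultilevelBound.

(** * The iterated logarithm at dyadic scales *)

Section ExceptionalPoints.
Variable R : realType.
Local Notation mu := (@lebesgue_measure R).
Local Notation C := R[i].
Implicit Types (x : R) (c : C).

Lemma eN x : e (- x) = (e x)^-1 :> C.
Proof.
by apply: (mulfI (e_neq0 x)); rewrite -eD subrr e0 divff // e_neq0.
Qed.

Lemma e_int (z : int) : e (z%:~R : R) = 1 :> C.
Proof.
have enat n : e (n%:R : R) = 1 :> C by rewrite -[n%:R]mulr1 eMn e1 expr1n.
case: z => n; first exact: enat.
by rewrite NegzE mulrNz eN enat invr1.
Qed.

(** [e_neq1] applied to the fractional part. *)
Lemma e_eq1 x : e x = 1 :> C -> exists z : int, x = z%:~R.
Proof.
move=> ex; exists (Num.floor x); set z := Num.floor x.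
have /andP[h1 h2] : z%:~R <= x < (z + 1)%:~R by rewrite floor_itv.
have es : e (x - z%:~R) = 1 :> C by rewrite eD ex eN e_int invr1 mulr1.
have [//|/eqP nz] := eqVneq x (z%:~R).
have : e (x - z%:~R) != 1 :> C; last by rewrite es eqxx.
apply: e_neq1; rewrite intrD in h2; apply/andP; split; last by lra.
by rewrite subr_gt0 lt_neqAle h1 andbT eq_sym; apply/eqP.
Qed.

(** The exceptional points, if there are any, form a translate of [Z / p]. *)
Lemma ae_e_neq (p : R) c : p != 0 -> {ae mu, forall x, e (p * x) != c}.
Proof.
move=> p0.
have [[x0 ex0]|nex] := pselect (exists x0, e (p * x0) = c); last first.
  by apply: aeW => x; apply/eqP => h; apply: nex; exists x.
pose A := [set x0 + z%:~R / p | z in [set: int]].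
have cA : countable A by apply: (sub_countable (card_image_le _ _)); exact: countableP.
exists A; split.
- exact: countable_measurable.
- exact: countable_lebesgue_measure0.
- move=> x /= /negP; rewrite negbK => /eqP ex.
  have : e (p * (x - x0)) = 1 :> C.
    by rewrite mulrBr eD eN ex ex0 divff // -ex0 e_neq0.
  move=> /e_eq1[z hz]; exists z => //.
  by rewrite -hz mulrAC divff // mul1r addrC subrK.
Qed.

End ExceptionalPoints.

Section ScaleBound.
Variable R : realType.
Local Notation mu := (@lebesgue_measure R).

Lemma ae_imply2 (P Q S : R -> Prop) : (forall x, P x -> Q x -> S x) ->
  {ae mu, forall x, P x} -> {ae mu, forall x, Q x} -> {ae mu, forall x, S x}.
Proof.
move=> PQS hP hQ; apply: negligibleS (negligibleU hP hQ) => x /= nS.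
have [p|np] := pselect (P x); last by left.
by right => /= Qx; apply: nS; exact: PQS.
Qed.
Local Notation C := R[i].

Lemma ae_nonexceptional (q : nat) (a : C) : (0 < q)%N ->
  {ae mu, forall x, forall i j : nat, e (q%:R ^+ j * x) != a ^+ (q ^ i)}.
Proof.
move=> q0.
apply/ae_foralln => i; apply/ae_foralln => j.
by apply: ae_e_neq; rewrite expf_neq0 // pnatr_eq0 -lt0n.
Qed.

(** [multilevel_bound] at a point whose orbit avoids the singularities of all the
levels, where the transfer identities hold pointwise. *)
Lemma lil_dyadic_pointwise (q k : nat) (a : C) (x : R) :
  (2 <= q)%N -> (4 <= k)%N -> normc a <= 1 ->
  (forall i j : nat, e (q%:R ^+ j * x) != a ^+ (q ^ i)) ->
  let n := (2 ^ k)%N in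
  let b i := a ^+ (q ^ i) in
  let l := Num.sqrt (ln k%:R / n%:R) in
  let C0 := 3 / 2 * ((q%:R - 1) * (2 * ln 2)) ^+ 2 in
  let K1 := 4 * (1 + C0) + 1 in
  let K2 := (4 * q%:R + 3) * K1 in
  let g i := mart_diff q (lnd (b i)) in
  (forall i N, (i < k.*2)%N -> (N <= n)%N -> forall s : bool,
     expR (\sum_(N <= j < n) ((-1) ^+ s * l * g i (q%:R ^+ j * (q%:R ^+ i * x))
       - ((-1) ^+ s * l) ^+ 2 * quad_var q (g i) (q%:R ^+ j * (q%:R ^+ i * x)))) < (k.+1)%:R ^+ 3) ->
  (forall i, (i < 3 * k)%N ->
     orbit_sum q (mart_diff q (fun y => pot (b i) y ^+ 2)) n (q%:R ^+ i * x) <= n%:R) ->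
  (3 / 4) ^+ k * orbit_sum q (fun y => pot (b (3 * k)%N) y ^+ 2) n (q%:R ^+ (3 * k) * x) <= n%:R ->
  forall N, (N <= n)%N ->
  `|\sum_(0 <= j < N) lnd a (q%:R ^+ j * x)| <=
    (4 * (6 + K2) + 1 + K1) * Num.sqrt (n%:R * ln k%:R).
Proof.
move=> q2 k4 a1 good n b l C0 K1 K2 g H1 H2 H3 N Nn.
have q0 : (0 < q)%N by exact: ltnW.
have qR0 : 0 < q%:R :> R by rewrite ltr0n.
have q2R : 2 <= q%:R :> R by rewrite ler_nat.
have b1 i : normc (b i) <= 1 by exact: normcX_le1.
have bS i : b i ^+ q = b i.+1 by rewrite /b -exprM -expnSr.
pose y i j : R := q%:R ^+ j * (q%:R ^+ i * x).
have yS i j : q%:R * y i j = y i.+1 j by rewrite /y exprS; ring.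
have yE i j : e (y i j) != b i.
  by rewrite /y mulrA -exprD; exact: good.
have yE' i j : e (q%:R * y i j) != b i ^+ q by rewrite yS bS.
pose U i j := pot (b i) (y i j).
pose f i j := lnd (b i) (y i j).
pose m i j := mart_diff q (fun z => pot (b i) z ^+ 2) (y i j).
pose V i j := quad_var q (g i) (y i j).
have R1 i j : f i j = g i (y i j) + q%:R^-1 * f i.+1 j.
  by rewrite /g /mart_diff transfer_lnd // bS yS /f subrK.
have R2 i j : U i j ^+ 2 <= m i j + C0 + 3 / 4 * U i.+1 j ^+ 2.
  rewrite /m /mart_diff -/(U i j).
  have := transfer_pot_sqr_drift q2 (b1 i) (yE' i j).
  rewrite bS yS -/(U i.+1 j) -/C0; lra.
have R4 i j : `|f i j| <= U i j by exact: norm_lnd_le.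
have R3 i j : 0 <= V i j <= 2 * U i j ^+ 2 + (4 * q%:R + 1) * U i.+1 j ^+ 2.
  have L0 z : 0 <= transfer q (fun w => g i w ^+ 2) z by apply: transfer_ge0 => w; exact: sqr_ge0.
  rewrite /V /quad_var addr_ge0 ?sqr_ge0 //=.
  have hL : transfer q (fun w => g i w ^+ 2) (q%:R * y i j) <= 4 * q%:R * U i.+1 j ^+ 2.
    apply: le_trans (transfer_mart_diff_sqr q0 _ (periodic1_lnd _)) _.
    rewrite /U -yS -bS; apply: le_trans (transfer_pot_sqr_le q0 (b1 i) (yE' i j)).
    apply: le_transfer => w; rewrite -[X in X <= _]real_normK ?num_real //.
    by rewrite lerXn2r ?nnegrE ?pot_ge0 ?norm_lnd_le.
  have hg : g i (y i j) = f i j - q%:R^-1 * f i.+1 j by rewrite R1 addrK.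
  have sqU i' j' : f i' j' ^+ 2 <= U i' j' ^+ 2.
    rewrite -[X in X <= _]real_normK ?num_real //.
    by rewrite lerXn2r ?nnegrE ?pot_ge0 //.
  have h3 : (q%:R^-1 * f i.+1 j) ^+ 2 <= 2^-1 * U i.+1 j ^+ 2.
    rewrite exprMn; apply: ler_pM; rewrite ?sqr_ge0 //.
    have qi : q%:R^-1 <= 2^-1 :> R by rewrite lef_pV2 ?posrE.
    have qi0 : 0 <= q%:R^-1 :> R by rewrite invr_ge0.
    nra.
  have h4 : g i (y i j) ^+ 2 <= 2 * f i j ^+ 2 + 2 * (q%:R^-1 * f i.+1 j) ^+ 2.
    rewrite hg; have := sqr_ge0 (f i j + q%:R^-1 * f i.+1 j).
    set u := f i j; set v := _ * _; rewrite !expr2; lra.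
  have := sqU i j; lra.
have C00 : 0 <= C0 by rewrite mulr_ge0 ?sqr_ge0.
have E0 : \sum_(0 <= j < N) lnd a (q%:R ^+ j * x) = \sum_(0 <= j < N) f 0%N j.
  by apply: eq_bigr => j _; rewrite /f /y /b expn0 !expr0 mul1r.
rewrite E0; apply: (@multilevel_bound R q k C0 U f (fun i j => g i (y i j)) m V) => //.
- move=> i M ik Mn s; have := H1 i M ik Mn s.
  rewrite -ltr_ln ?posrE ?expR_gt0 ?exprn_gt0 // expRK lnXn // => /ltW h.
  rewrite (_ : 3 * ln k.+1%:R = ln k.+1%:R *+ 3 :> R); last by ring.
  congr (_ <= _) : h; apply: eq_bigr => j _.
  by rewrite exprMn sqrr_sign mul1r.
- by move=> i ik; rewrite big_mkord; exact: H2.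
- by rewrite big_mkord; exact: H3.
Qed.

(** Three families of bad events are discarded: failures of the maximal inequality,
of the square-mean bound for the martingale part of the squared potentials, and
of the first-moment bound at the last level of the drift.  By invariance of the
measure, evaluating a function of level [i] at [q^i x] does not change its
integral. *)
Lemma lil_dyadic (q : nat) (a : C) : (2 <= q)%N -> normc a <= 1 ->
  exists2 B : R, 0 < B &
  {ae mu, forall x, 0 <= x < 1 -> exists k0 : nat, forall k, (k0 <= k)%N ->
     forall N, (N <= 2 ^ k)%N ->
     `|\sum_(0 <= j < N) lnd a (q%:R ^+ j * x)| <= B * Num.sqrt ((2 ^ k)%:R * ln k%:R)}.
Proof.
move=> q2 a1.
have q0 : (0 < q)%N by exact: ltnW.
pose b i := a ^+ (q ^ i).
have b1 i : normc (b i) <= 1 by exact: normcX_le1.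
pose C0 : R := 3 / 2 * ((q%:R - 1) * (2 * ln 2)) ^+ 2.
pose K1 := 4 * (1 + C0) + 1.
pose K2 := (4 * q%:R + 3) * K1.
have C00 : 0 <= C0 by rewrite mulr_ge0 ?sqr_ge0.
exists (4 * (6 + K2) + 1 + K1).
  have K1p : 1 <= K1 by rewrite /K1; lra.
  have qp : 0 <= q%:R :> R by [].
  have : 0 <= K2 by apply: mulr_ge0; lra.
  by lra.
pose g i := mart_diff q (lnd (b i)).
pose l k : R := Num.sqrt (ln k%:R / (2 ^ k)%:R).
have mg i : measurable_fun setT (g i) by apply: measurable_mart_diff; exact: measurable_lnd.
have pg i : periodic1 (g i) by apply: periodic1_mart_diff => //; exact: periodic1_lnd.
have g0 i x : transfer q (g i) x = 0 by apply: transfer_mart_diff => //; exact: periodic1_lnd.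
pose a_ k : R := k.+1%:R ^+ 3.
have a0 k : 0 < a_ k by rewrite exprn_gt0.
have ia0 k : 0 <= (a_ k)^-1 by rewrite invr_ge0 ltW.
have [F HF] := choice (fun p : nat * nat * bool =>
   @maximal_function R q q0 (g p.1.2) ((-1) ^+ p.2 * l p.1.1) (a_ p.1.1) (2 ^ p.1.1) (mg p.1.2) (pg p.1.2) (g0 p.1.2)).
have mF p : measurable_fun setT (F p) by have [] := HF p.
have pF p : periodic1 (F p) by have [] := HF p.
have F0 p x : 0 <= F p x by have [_ _ h _ _] := HF p; exact: h.
have iF p : (int01 (F p) <= 1)%E by have [] := HF p.
pose sq i y := pot (b i) y ^+ 2.
have msq i : measurable_fun setT (sq i) by apply: measurable_funX; exact: measurable_pot.
have psq i : periodic1 (sq i) by move=> x; rewrite /sq periodic1_pot.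
have [K K0 HK] := int01_pot4 R.
have isq2 i : (int01 (fun x => sq i x ^+ 2)%R <= K%:E)%E.
  by rewrite /sq; under eq_fun do rewrite -exprM; exact: HK.
(* There are [4k] terms, each of integral at most [(k + 1)^(-3)]. *)
pose W1 k x := \sum_(p <- [seq (i, s) | i <- iota 0 k.*2, s <- [:: true; false]])
   (a_ k)^-1 * F (k, p.1, p.2) (q%:R ^+ p.1 * x).
have int1 k : (int01 (W1 k) <= (4 * k%:R / a_ k)%:E)%E.
  rewrite int01_sum; last 2 first.
  - by move=> p; apply: measurable_scalel; exact: measurable_mulq.
  - by move=> p x; rewrite mulr_ge0.
  apply: (@le_trans _ _ (\sum_(p <- [seq (i, s) | i <- iota 0 k.*2, s <- [:: true; false]]) ((a_ k)^-1)%:E)%E).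
    apply: lee_sum => p _; rewrite int01Z //; last exact: measurable_mulq.
    rewrite (int01_exp _ q0) //.
    by rewrite -[X in (_ <= X)%E]mule1 lee_pmul2l ?lte_fin ?invr_gt0.
  rewrite sumEFin lee_fin big_const_seq count_predT size_allpairs size_iota /=.
  rewrite iter_addr_0 -[X in X <= _]mulr_natl ler_wpM2r //.
  by rewrite natrM -mul2n natrM; lra.
have ev1 := @borel_cantelli_int01 R W1 (fun k => 4 * k%:R / a_ k) 8 _ _ int1 _.
have {}ev1 : {ae mu, forall x, 0 <= x < 1 -> exists k0 : nat, forall k, (k0 <= k)%N -> W1 k x < 1}.
  apply: ev1.
  - move=> k; apply: measurable_sumr => p.
    by apply: measurable_scalel; exact: measurable_mulq.
  - by move=> k x; apply: sumr_ge0 => p _; rewrite mulr_ge0.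
  (* [4k / (k+1)^3] is at most the telescoping difference [8 / (k+1) - 8 / (k+2)]. *)
  move=> n; apply: (@le_trans _ _ (8 - 8 / n.+1%:R)); last by rewrite gerBl divr_ge0.
  elim: n => [|n IH]; first by rewrite big_ord0 divr1 subrr.
  rewrite big_ord_recr /=; apply: le_trans (lerD IH (lexx _)) _.
  rewrite -subr_ge0 /a_ -(natr1 n.+1); set t := n.+1%:R : R.
  have t1 : 1 <= t by rewrite /t ler1n.
  have -> : n%:R = t - 1 by rewrite /t -natr1 addrK.
  have -> : 8 - 8 / (t + 1) - (8 - 8 / t + 4 * (t - 1) / t ^+ 3) =
     (8 * t ^+ 2 - 4 * (t - 1) * (t + 1)) / (t ^+ 3 * (t + 1)).
    by field; apply/andP; split; lra.
  apply: divr_ge0; first by nra.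
  by rewrite mulr_ge0 ?exprn_ge0 //; lra.
pose M k i := orbit_sum q (mart_diff q (sq i)) (2 ^ k).
pose W2 k x := \sum_(i <- iota 0 (3 * k)) ((2 ^ k)%:R ^- 2) * M k i (q%:R ^+ i * x) ^+ 2.
have n0 k : 0 < (2 ^ k)%:R :> R by rewrite ltr0n expn_gt0.
have mM k i : measurable_fun setT (M k i).
  by apply: measurable_orbit_sum; apply: measurable_mart_diff.
have pM k i : periodic1 (M k i).
  by apply: periodic1_orbit_sum => //; apply: periodic1_mart_diff.
have mM2 k i : measurable_fun setT (fun x => M k i x ^+ 2) by exact: measurable_funX.
have int2 k : (int01 (W2 k) <= (9 * K * (2 / 3) ^+ k)%:E)%E.
  rewrite int01_sum; last 2 first.
  - by move=> i; apply: measurable_scalel; apply: (measurable_mulq (f := fun x => M k i x ^+ 2)).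
  - by move=> i x; rewrite mulr_ge0 ?sqr_ge0 // invr_ge0 exprn_ge0.
  apply: (@le_trans _ _ (\sum_(i <- iota 0 (3 * k)) (K / (2 ^ k)%:R)%:E)%E).
    apply: lee_sum => i _; rewrite int01Z; last 3 first.
    - by rewrite invr_ge0 exprn_ge0.
    - exact: (measurable_mulq (f := fun x => M k i x ^+ 2)).
    - by move=> x; exact: sqr_ge0.
    rewrite (@int01_exp _ q i (fun x => M k i x ^+ 2)) //; last 2 first.
    - by move=> x; rewrite pM.
    - by move=> x; exact: sqr_ge0.
    have := int01_orbit_sum_mart_diff q0 (2 ^ k) (msq i) (psq i).
    move=> /le_trans h.
    apply: (@le_trans _ _ (((2 ^ k)%:R ^- 2)%:E * ((2 ^ k)%:R%:E * K%:E))%E).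
      apply: lee_wpmul2l; first by rewrite lee_fin invr_ge0 exprn_ge0.
      by apply: h; apply: lee_wpmul2l; rewrite ?lee_fin.
    rewrite -!EFinM lee_fin le_eqVlt; apply/orP; left; apply/eqP.
    by field; rewrite gt_eqF.
  rewrite sumEFin lee_fin big_const_seq count_predT size_iota iter_addr_0 -[X in X <= _]mulr_natl natrM.
  (* Bernoulli's inequality trades the factor [k] for a geometric one. *)
  have hk : k%:R <= 3 * (4 / 3) ^+ k :> R.
    elim: (k) => [|j IH]; first by rewrite expr0; lra.
    rewrite -natr1 exprS.
    have : 1 <= (4 / 3) ^+ j :> R by apply: exprn_ege1; lra.
    lra.
  have -> : 9 * K * (2 / 3) ^+ k = 3 * (3 * (4 / 3) ^+ k) * (K / (2 ^ k)%:R).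
    have -> : 2 / 3 = (4 / 3) / 2 :> R by field.
    by rewrite natrX expr_div_n; field; rewrite expf_neq0.
  by apply: ler_wpM2r; [exact: divr_ge0 (ltW (n0 k)) | rewrite ler_pM2l].
have ev2 : {ae mu, forall x, 0 <= x < 1 -> exists k0 : nat, forall k, (k0 <= k)%N -> W2 k x < 1}.
  apply: (@borel_cantelli_int01 R W2 (fun k => 9 * K * (2 / 3) ^+ k) (9 * K * (1 - 2 / 3)^-1) _ _ int2).
  - move=> k; apply: measurable_sumr => i.
    by apply: measurable_scalel; apply: (measurable_mulq (f := fun x => M k i x ^+ 2)).
  - by move=> k x; apply: sumr_ge0 => i _; rewrite mulr_ge0 ?sqr_ge0 // invr_ge0 exprn_ge0.
  - by move=> n; rewrite -mulr_sumr ler_wpM2l ?mulr_ge0 // sum_geo_le //; lra.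
pose T k := orbit_sum q (sq (3 * k)%N) (2 ^ k).
have mT k : measurable_fun setT (T k) by exact: measurable_orbit_sum.
have pT k : periodic1 (T k) by exact: periodic1_orbit_sum.
have sq0 i x : 0 <= sq i x by exact: sqr_ge0.
have T0 k x : 0 <= T k x by apply: sumr_ge0.
pose W3 k x := ((3 / 4) ^+ k / (2 ^ k)%:R) * T k (q%:R ^+ (3 * k) * x).
have c0 k : 0 <= (3 / 4) ^+ k / (2 ^ k)%:R :> R by rewrite divr_ge0 // exprn_ge0 // divr_ge0.
have int3 k : (int01 (W3 k) <= ((1 + K) * (3 / 4) ^+ k)%:E)%E.
  rewrite int01Z //; last exact: measurable_mulq.
  rewrite (int01_exp _ q0) // int01_sum; last 2 first.
  - by move=> j; exact: measurable_mulq.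
  - by move=> j x.
  apply: (@le_trans _ _ (((3 / 4) ^+ k / (2 ^ k)%:R)%:E * (\sum_(j < 2 ^ k) (1 + K)%:E))%E).
    apply: lee_wpmul2l; first by rewrite lee_fin.
    apply: lee_sum => j _; rewrite (int01_exp _ q0) //.
    apply: (@le_trans _ _ (int01 (fun x => 1 + sq (3 * k)%N x ^+ 2)%R)).
      apply: le_int01 => //.
      - by apply: measurable_funD => //; exact: measurable_funX.
      - move=> x; have := sqr_ge0 (sq (3 * k)%N x - 1); have := sq0 (3 * k)%N x.
        rewrite !expr2; lra.
    rewrite int01D //; last 2 first.
    - exact: measurable_funX.
    - by move=> x; exact: sqr_ge0.
    by rewrite int01_cst EFinD leeD2l.
  rewrite sumEFin sumr_const card_ord -[_ *+ (2 ^ k)]mulr_natl -EFinM lee_fin.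
  rewrite le_eqVlt; apply/orP; left; apply/eqP; field.
  by rewrite natrX expf_neq0.
have ev3 : {ae mu, forall x, 0 <= x < 1 -> exists k0 : nat, forall k, (k0 <= k)%N -> W3 k x < 1}.
  apply: (@borel_cantelli_int01 R W3 (fun k => (1 + K) * (3 / 4) ^+ k) ((1 + K) * (1 - 3 / 4)^-1) _ _ int3).
  - by move=> k; apply: measurable_scalel; exact: measurable_mulq.
  - by move=> k x; rewrite mulr_ge0.
  - by move=> n; rewrite -mulr_sumr ler_wpM2l ?addr_ge0 // sum_geo_le //; lra.
have good := ae_nonexceptional a q0.
have ev12 := ae_imply2 (fun x h1 h2 => conj h1 h2) ev1 ev2.
have ev3g := ae_imply2 (fun x h1 h2 => conj h1 h2) ev3 good.
apply: ae_imply2 ev12 ev3g => x [/[swap] h2 h1] [h3 gx] xI.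
move: h1 h2 h3 => /(_ xI)[k1 h1] /(_ xI)[k2 h2] /(_ xI)[k3 h3].
exists (maxn (maxn k1 k2) (maxn k3 4)) => k.
rewrite !geq_max => /andP[/andP[/h1 {}h1 /h2 {}h2] /andP[/h3 {}h3 k4]].
apply: (@lil_dyadic_pointwise q k a x q2 k4 a1 gx).
- move=> i N ik Nn s.
  have [_ _ _ _ hF] := HF (k, i, s).
  apply: hF => //=.
  have : (a_ k)^-1 * F (k, i, s) (q%:R ^+ i * x) < 1.
    apply: le_lt_trans h1; rewrite /W1.
    have ins : (i, s) \in [seq (i, s) | i <- iota 0 k.*2, s <- [:: true; false]].
      by apply/allpairsP; exists (i, s); split=> //=; rewrite ?mem_iota //; case: (s).
    rewrite (big_rem _ ins) /= lerDl sumr_ge0 // => p _.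
    by rewrite mulr_ge0.
  by rewrite ltr_pdivrMl // mulr1.
- move=> i ik.
  have : ((2 ^ k)%:R ^- 2) * M k i (q%:R ^+ i * x) ^+ 2 < 1.
    apply: le_lt_trans h2; rewrite /W2.
    have ins : i \in iota 0 (3 * k) by rewrite mem_iota.
    rewrite (big_rem _ ins) /= lerDl sumr_ge0 // => p _.
    by rewrite mulr_ge0 ?sqr_ge0 // invr_ge0 exprn_ge0.
  rewrite ltr_pdivrMl ?exprn_gt0 // mulr1 => /ltW.
  rewrite -[M k i _ ^+ 2]real_normK ?num_real // ler_sqr ?nnegrE //.
  by move=> /(le_trans (ler_norm _)).
- move: h3; rewrite /W3 mulrAC ltr_pdivrMr // mul1r => /ltW.
  by [].
Qed.

End ScaleBound.

(** * The iterated logarithm for trigonometric polynomials *)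

Section IteratedLogarithm.
Variable R : realType.
Local Notation mu := (@lebesgue_measure R).
Local Notation C := R[i].

Definition lil_rate (n : nat) : R := Num.sqrt (n%:R * ln (ln n%:R)).

Lemma lil_rate_ge0 n : 0 <= lil_rate n. Proof. exact: sqrtr_ge0. Qed.

Lemma ln2_ge_half : 2^-1 <= ln 2 :> R.
Proof. by rewrite -ler_expR lnK ?posrE // expR_half_le2. Qed.

(** For [2^(k-1) <= n] one has [k <= (ln n)^2] as soon as [k >= 6], whence
[ln k <= 2 ln (ln n)]. *)
Lemma dyadic_rate_le (n k : nat) : (6 <= k)%N -> (2 ^ k.-1 <= n)%N ->
  Num.sqrt ((2 ^ k)%:R * ln k%:R) <= 2 * lil_rate n.
Proof.
move=> k6 kn.
have k0 : 0 < k%:R :> R by rewrite ltr0n; lia.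
have n0 : 0 < n%:R :> R by rewrite ltr0n; apply: leq_trans kn; rewrite expn_gt0.
have k6R : 6 <= k%:R :> R by rewrite ler_nat.
have kE : k%:R = 1 + k.-1%:R :> R by rewrite nat1r prednK //; lia.
have lnn : (k%:R - 1) / 2 <= ln n%:R :> R.
  apply: (@le_trans _ _ (ln (2 ^ k.-1)%:R)); last first.
    have p0 : 0 < (2 ^ k.-1)%:R :> R by rewrite ltr0n expn_gt0.
    by rewrite ler_ln ?posrE // ler_nat.
  rewrite natrX lnXn // -mulr_natl.
  have := ler_wpM2l (ler0n R k.-1) ln2_ge_half; lra.
have lnn0 : 0 < ln n%:R :> R by apply: lt_le_trans lnn; lra.
have lk : ln k%:R <= 2 * ln (ln n%:R) :> R.
  have -> : 2 * ln (ln n%:R) = ln (ln n%:R * ln n%:R) :> R by rewrite lnM ?posrE //; ring.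
  rewrite ler_ln ?posrE ?mulr_gt0 //.
  have : ((k%:R - 1) / 2) * ((k%:R - 1) / 2) <= ln n%:R * ln n%:R :> R by apply: ler_pM => //; lra.
  apply: le_trans; nra.
have lk1 : 0 <= ln k%:R :> R by apply: ln_ge0; lra.
have -> : 2 * lil_rate n = Num.sqrt (4 * (n%:R * ln (ln n%:R))).
  rewrite [RHS]sqrtrM // (_ : 4 = 2 ^+ 2 :> R); last by ring.
  by rewrite sqrtr_sqr ger0_norm.
apply: ler_wsqrtr.
have -> : 4 * (n%:R * ln (ln n%:R)) = (2 * n%:R) * (2 * ln (ln n%:R)) :> R by ring.
apply: ler_pM => //.
rewrite -natrM ler_nat; have -> : k = k.-1.+1 by lia.
by rewrite expnS leq_mul2l.
Qed.

Lemma periodic_int (P : R -> Prop) : (forall x, P (x + 1) <-> P x) ->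
  forall (n : nat) x, P (x + n%:R) <-> P x.
Proof.
move=> Pp; elim=> [|n IH] x; first by rewrite addr0.
by rewrite -natr1 addrA Pp.
Qed.

Lemma negligible_translate (A : set R) (c : R) :
  mu.-negligible A -> mu.-negligible [set x | A (x + c)].
Proof.
move=> [N [mN N0 AN]]; exists (affine_map 1 c @^-1` N); split.
- by rewrite -[X in measurable X]setTI; apply: measurable_affine_map.
- by have := lebesgue_measure_affine c (@ltr01 R) mN; rewrite N0 mul1e => <-.
- by move=> x /=; rewrite /affine_map mul1r => /AN.
Qed.

Lemma ae_periodic (P : R -> Prop) : (forall x, P (x + 1) <-> P x) ->
  {ae mu, forall x, 0 <= x < 1 -> P x} -> {ae mu, forall x, P x}.
Proof.
move=> Pp aeP.
pose A := [set x | ~ (0 <= x < 1 -> P x)].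
have nA : mu.-negligible A by exact: aeP.
apply: negligibleS (negligibleU
  (negligible_bigcup (fun n => negligible_translate n%:R nA))
  (negligible_bigcup (fun n => negligible_translate (- n%:R) nA))).
move=> x /= nP.
have : 0 <= x - (Num.floor x)%:~R < 1.
  have /andP[h1 h2] := floor_itv x; rewrite intrD in h2.
  by rewrite subr_ge0 h1 ltrBlDl.
case: (Num.floor x) => n hx; [right|left].
  exists n => //=; rewrite /A /= => h; apply: nP.
  by rewrite -(subrK n%:R x); apply/(periodic_int Pp n); exact: h hx.
exists n.+1 => //=; rewrite /A /= => h; apply: nP.
move: hx; rewrite NegzE mulrNz opprK => hx.
by apply/(periodic_int Pp n.+1); exact: h hx.
Qed.

Lemma lnd_shift (q : nat) (a : C) (x : R) j :
  lnd a (q%:R ^+ j * (x + 1)) = lnd a (q%:R ^+ j * x).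
Proof. by rewrite -natrX mulrDr mulr1 periodic1_nat //; exact: periodic1_lnd. Qed.

(** Every [n] lies between two consecutive powers of two, and [lil_dyadic] bounds all
the partial sums up to the larger one. *)
Theorem lil_lnd (q : nat) (a : C) : (2 <= q)%N -> normc a <= 1 ->
  exists2 B : R, 0 < B &
  {ae mu, forall x, exists n0 : nat, forall n, (n0 <= n)%N ->
     `|\sum_(0 <= j < n) lnd a (q%:R ^+ j * x)| <= B * lil_rate n}.
Proof.
move=> q2 a1; have [B B0 HB] := @lil_dyadic R q a q2 a1.
exists (B * 2); first by rewrite mulr_gt0.
apply: ae_periodic.
  have E n x : \sum_(0 <= j < n) lnd a (q%:R ^+ j * (x + 1)) =
      \sum_(0 <= j < n) lnd a (q%:R ^+ j * x).
    by apply: eq_bigr => j _; exact: lnd_shift.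
  by move=> x; split => -[n0 h]; exists n0 => n /h; rewrite E.
apply: (ae_imply2 _ HB HB) => x h _ xI; have [k0 hk] := h xI.
exists (2 ^ (maxn k0 6))%N => n nge.
pose k := (trunc_log 2 n).+1.
have n0 : (0 < n)%N by apply: leq_trans nge; rewrite expn_gt0.
have kge : (maxn k0 6 < k)%N by rewrite /k ltnS; apply: trunc_log_max.
move: kge; rewrite gtn_max => /andP[kk0 k6].
apply: (le_trans (hk k (ltnW kk0) n _)).
  by apply: ltnW; exact: trunc_log_ltn.
rewrite -mulrA ler_pM2l //; apply: dyadic_rate_le; first exact: ltnW.
by rewrite /k /=; exact: trunc_logP.
Qed.

Lemma normc_conj (r : C) : normc (r^*)%C = normc r.
Proof. by case: r => u v; rewrite /normc /= sqrrN. Qed.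

Lemma conjcB (u v : C) : ((u - v)^*)%C = (u^*)%C - (v^*)%C.
Proof. exact: rmorphB. Qed.

Lemma conj_e (x : R) : ((e x)^*)%C = (e x)^-1 :> C.
Proof. by rewrite -eN /e /= mulrN cosN sinN. Qed.

(** The reflection of [r] across the unit circle satisfies
[|e(x) - r| = |r| |e(x) - 1 / conj(r)|]. *)
Lemma lnd_reflect (r : C) (x : R) : 1 < normc r -> e x != r ->
  lnd r x = ln (normc r) + lnd ((r^*)%C^-1) x.
Proof.
move=> r1 er.
have r0 : r != 0 by apply: contraTneq r1 => ->; rewrite normc0 ltr10.
have dE : dist_e r x = normc r * dist_e ((r^*)%C^-1) x.
  rewrite /dist_e -(normc_conj (e x - (r^*)%C^-1)) conjcB conjc_inv conjcK conj_e -normcM.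
  rewrite mulrBr divff // -[LHS]normcN opprB.
  rewrite -[LHS]mulr1 -[X in _ * X](normc_e (- x)) eN -normcM mulrBl divff ?e_neq0 //.
have dpos : 0 < dist_e r x by rewrite normc_gt0 // subr_eq0.
rewrite /lnd dE lnM //; rewrite posrE.
  by apply: lt_trans r1.
by move: dpos; rewrite dE pmulr_rgt0 //; apply: lt_trans r1.
Qed.

Lemma lil_roots (q : nat) (rs : seq C) : (2 <= q)%N ->
  exists I B : R, [/\ 0 <= I, 0 < B &
  {ae mu, forall x, (forall r j, r \in rs -> e (q%:R ^+ j * x) != r) /\
     exists n0 : nat, forall n, (n0 <= n)%N ->
     `|\sum_(0 <= j < n) (\sum_(r <- rs) lnd r (q%:R ^+ j * x)) - n%:R * I| <= B * lil_rate n}].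
Proof.
move=> q2; elim: rs => [|r rs [I [B [I0 B0 IH]]]].
  exists 0, 1; split => //; apply: aeW => x; split => //; exists 0%N => n _.
  rewrite mulr0 subr0 big1 => [|j _]; last by rewrite big_nil.
  by rewrite normr0 mul1r lil_rate_ge0.
have [I1 [B1 [I10 B10 H1]]] : exists I B : R, [/\ 0 <= I, 0 < B &
    {ae mu, forall x, (forall j, e (q%:R ^+ j * x) != r) /\
     exists n0 : nat, forall n, (n0 <= n)%N ->
     `|\sum_(0 <= j < n) lnd r (q%:R ^+ j * x) - n%:R * I| <= B * lil_rate n}].
  have ner : {ae mu, forall x, forall j, e (q%:R ^+ j * x) != r}.
    apply/ae_foralln => j; apply: ae_e_neq.
    by rewrite expf_neq0 // pnatr_eq0 -lt0n ltnW.
  have [r1|r1] := leP (normc r) 1.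
    have [B' B'0 HB'] := lil_lnd q2 r1.
    exists 0, B'; split => //; apply: ae_imply2 ner HB' => x h [n0 hn]; split => //.
    by exists n0 => n /hn; rewrite mulr0 subr0.
  have r1' : normc ((r^*)%C^-1) <= 1.
    by rewrite normcV normc_conj invf_le1 // ?ltW //; apply: lt_trans r1.
  have [B' B'0 HB'] := lil_lnd q2 r1'.
  exists (ln (normc r)), B'; split => //; first by rewrite ln_ge0 // ltW.
  apply: ae_imply2 ner HB' => x h [n0 hn]; split => //.
  exists n0 => n /hn.
  have -> : \sum_(0 <= j < n) lnd r (q%:R ^+ j * x) =
      n%:R * ln (normc r) + \sum_(0 <= j < n) lnd ((r^*)%C^-1) (q%:R ^+ j * x).
    rewrite (eq_bigr (fun j => ln (normc r) + lnd ((r^*)%C^-1) (q%:R ^+ j * x))) => [|j _].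
      by rewrite big_split /= sumr_const_nat subn0 -[ln (normc r) *+ n]mulr_natl.
    by apply: lnd_reflect.
  by rewrite addrAC subrr add0r.
exists (I1 + I), (B1 + B); split; [exact: addr_ge0 | exact: addr_gt0 |].
apply: ae_imply2 H1 IH => x [g1 [n1 h1]] [g2 [n2 h2]]; split.
  by move=> s j; rewrite inE => /orP[/eqP -> //|]; exact: g2.
exists (maxn n1 n2) => n; rewrite geq_max => /andP[/h1 {}h1 /h2 {}h2].
rewrite (eq_bigr (fun j => lnd r (q%:R ^+ j * x) + \sum_(r <- rs) lnd r (q%:R ^+ j * x))); last first.
  by move=> j _; rewrite big_cons.
rewrite big_split /= mulrDr opprD addrACA mulrDl.
by apply: le_trans (ler_normD _ _) _; exact: lerD.
Qed.

(** The number [I] is the logarithmic Mahler measure of [p]; its nonnegativity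
reflects that the leading coefficient has modulus one. *)
Theorem lil_poly (q : nat) (p : {poly C}) : (2 <= q)%N -> normc (lead_coef p) = 1 ->
  exists I B : R, [/\ 0 <= I, 0 < B &
  {ae mu, forall x, (forall j, p.[e (q%:R ^+ j * x)] != 0) /\
     exists n0 : nat, forall n, (n0 <= n)%N ->
     `|\sum_(0 <= j < n) ln (normc p.[e (q%:R ^+ j * x)]) - n%:R * I| <= B * lil_rate n}].
Proof.
move=> q2 lc1; have [rs pE] := closed_field_poly_normal p.
have [I [B [I0 B0 H]]] := lil_roots rs q2.
exists I, B; split => //.
have hE z : normc p.[z] = \prod_(r <- rs) normc (z - r).
  rewrite pE hornerZ normcM lc1 mul1r horner_prod normc_prod.
  by apply: eq_bigr => r _; rewrite !hornerE.
apply: (ae_imply2 _ H H) => x [g [n0 h]] _; split.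
  move=> j; rewrite pE hornerZ mulf_neq0 //.
    by apply: contra_eq_neq lc1 => ->; rewrite normc0 eq_sym oner_eq0.
  rewrite horner_prod prodf_seq_neq0; apply/allP => r rrs /=.
  by rewrite !hornerE subr_eq0; exact: g.
exists n0 => n /h.
rewrite (eq_bigr (fun j => ln (normc p.[e (q%:R ^+ j * x)]))) // => j _.
rewrite -[LHS]expRK expR_sum hE; congr ln.
rewrite big_seq_cond [RHS]big_seq_cond; apply: eq_bigr => r; rewrite andbT => rrs.
by rewrite /lnd lnK // posrE normc_gt0 // subr_eq0; exact: g.
Qed.
End IteratedLogarithm.

(** * Aperiodic substitutions separate the two letters *)

Section Periodicity.

Lemma nth_flatten_nseq (T : Type) (x0 : T) (u : seq T) (n i : nat) :
  (i < n * size u)%N -> nth x0 (flatten (nseq n u)) i = nth x0 u (i %% size u).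
Proof.
elim: n i => [|n IH] i //; rewrite mulSn => ilt /=.
rewrite nth_cat; case: ltnP => h; first by rewrite modn_small.
rewrite IH; last by rewrite ltn_subLR.
by rewrite -{2}(subnK h) modnDr.
Qed.

(** If all letters have the same image [u], then every iterate is a power of [u], and
the bi-infinite repetition of [u] is a periodic point of the subshift. *)
Lemma constant_subst_not_aperiodic (m q : nat) (zeta : 'I_m -> seq 'I_m)
    (a : 'I_m) (u : seq 'I_m) :
  (2 <= q)%N -> constant_length zeta q -> (forall b, zeta b = u) ->
  ~ aperiodic_subst zeta.
Proof.
move=> q2 cl zu ap.
have su : size u = q by rewrite -(zu a) cl.
have q0 : (0 < q)%N by exact: ltnW.
pose x (k : int) := nth a u `|(k %% q%:Z)%Z|%N.
apply: (ap x); last first.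
  by exists q => // k; rewrite /x modzDr.
move=> k l; exists (`|(k %% q%:Z)%Z| + l).+1%N, a.
set r := `|(k %% q%:Z)%Z|%N.
have subE w : subst_word zeta w = flatten (nseq (size w) u).
  rewrite /subst_word; congr flatten.
  by elim: w => //= b w ->; rewrite zu.
have iterE n : iter n.+1 (subst_word zeta) [:: a] = flatten (nseq (q ^ n) u).
  elim: n => [|n IH] /=; first by rewrite subE.
  rewrite -/(iter n.+1 (subst_word zeta) [:: a]) IH subE.
  by rewrite size_flatten /shape map_nseq sumn_nseq su -expnS.
rewrite iterE; set n := (q ^ _)%N.
have rln : (r + l <= n * q)%N.
  have : (r + l < n)%N by exact: ltn_expl.
  by move=> /ltnW /leq_trans; apply; rewrite leq_pmulr.
have sF : size (flatten (nseq n u)) = (n * q)%N.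
  by rewrite size_flatten /shape map_nseq sumn_nseq su mulnC.
have -> : [seq x (k + i%:Z) | i <- iota 0 l] = take l (drop r (flatten (nseq n u))).
  apply: (@eq_from_nth _ a).
    by rewrite size_map size_iota size_takel // size_drop sF leq_subRL //; lia.
  move=> i; rewrite size_map size_iota => il.
  rewrite (nth_map 0%N) ?size_iota // nth_iota // add0n nth_take // nth_drop.
  rewrite nth_flatten_nseq ?su; last by lia.
  rewrite /x; congr nth.
  have -> : ((k + i%:Z) %% q%:Z)%Z = ((r + i)%N %% q)%N.
    rewrite -modzDml -modz_nat PoszD /r gez0_abs // modz_ge0 //; lia.
  by [].
apply/infixP; exists (take r (flatten (nseq n u))), (drop l (drop r (flatten (nseq n u)))).
by rewrite cat_take_drop cat_take_drop.
Qed.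

Lemma aperiodic_subst_neq (q : nat) (zeta : 'I_2 -> seq 'I_2) :
  (2 <= q)%N -> constant_length zeta q -> aperiodic_subst zeta ->
  zeta 0 != zeta 1.
Proof.
move=> q2 cl ap; apply/eqP => z01.
apply: (constant_subst_not_aperiodic 0 (u := zeta 0) q2 cl _ ap) => b.
case: b => -[|[|//]] hb.
  by congr zeta; exact: val_inj.
by rewrite z01; congr zeta; exact: val_inj.
Qed.
End Periodicity.

(** * Comparison of a matrix norm with the entries *)

Lemma coord_le_norm (R : realType) n (v : 'rV[R]_n) k : `|v 0 k| <= `|v|.
Proof.
rewrite [X in _ <= X]mx_normrE.
exact: (@le_bigmax _ _ _ 0 (fun i : 'I_1 * 'I_n => `|v i.1 i.2|) (0, k)).
Qed.

Section NormComparison.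
Variables (R : realType) (N : 'M[R[i]]_2 -> R).
Hypothesis Nnorm : is_matrix_norm N.
Local Notation C := R[i].

Lemma normC_normc (c : C) : `|c| = (normc c)%:C%C.
Proof. by case: c. Qed.

Lemma mnormZ c A : N (c *: A) = normc c * N A.
Proof.
have [_ _ h] := Nnorm; have := h c A.
by rewrite normC_normc -rmorphM => /complexI.
Qed.

Lemma mnorm_triangle A B : N (A + B) <= N A + N B.
Proof. by have [_ h _] := Nnorm. Qed.

Lemma mnorm0 : N 0 = 0.
Proof. by rewrite -(scale0r (0 : 'M[C]_2)) mnormZ normc0 mul0r. Qed.

Lemma mnormN A : N (- A) = N A.
Proof. by rewrite -scaleN1r mnormZ normcN normc1 mul1r. Qed.

Lemma mnorm_ge0 A : 0 <= N A.
Proof.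
have := mnorm_triangle A (- A); rewrite subrr mnorm0 mnormN; lra.
Qed.

Lemma mnorm_sum (I : Type) (s : seq I) (F : I -> 'M[C]_2) :
  N (\sum_(i <- s) F i) <= \sum_(i <- s) N (F i).
Proof.
elim: s => [|i s IH]; first by rewrite !big_nil mnorm0.
by rewrite !big_cons; apply: le_trans (mnorm_triangle _ _) _; rewrite lerD2l.
Qed.

Lemma mnorm_le_entries : exists2 K : R, 0 < K &
  forall (A : 'M[C]_2) (M : R), (forall i j, normc (A i j) <= M) -> N A <= K * M.
Proof.
exists (1 + \sum_i \sum_j N (delta_mx i j)).
  by rewrite ltr_pwDl // sumr_ge0 // => i _; rewrite sumr_ge0 // => j _; exact: mnorm_ge0.
move=> A M AM.
have M0 : 0 <= M by apply: le_trans (AM 0 0); case: (A 0 0) => ? ?; exact: sqrtr_ge0.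
rewrite [A in N A]matrix_sum_delta mulrDl mul1r.
apply: le_trans (mnorm_sum _ _) _.
rewrite mulr_suml -[X in X <= _]add0r lerD //; apply: ler_sum => i _.
apply: le_trans (mnorm_sum _ _) _.
rewrite mulr_suml; apply: ler_sum => j _.
by rewrite mnormZ mulrC ler_wpM2l // mnorm_ge0.
Qed.

(** Real coordinates on the complex matrices, used to transport the compactness of
the unit sphere of [R^8]. *)
Definition mx_of_coords (v : 'rV[R]_8) : 'M[C]_2 :=
  \matrix_(i, j) Complex (v 0 (inord (4 * i + 2 * j))) (v 0 (inord (4 * i + 2 * j + 1))).

Lemma mx_of_coords_linear a (u v : 'rV[R]_8) :
  mx_of_coords (a *: u + v) = (a%:C)%C *: mx_of_coords u + mx_of_coords v.
Proof.
apply/matrixP => i j; rewrite !mxE; apply/eqP; rewrite eq_complex /= !mul0r subr0 addr0.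
by rewrite !eqxx.
Qed.

Definition coords_of_mx (A : 'M[C]_2) : 'rV[R]_8 :=
  \row_k (let c := A (inord (k %/ 4)) (inord ((k %% 4) %/ 2)) in
          if odd k then complex.Im c else complex.Re c).

Lemma coords_of_mxK A : mx_of_coords (coords_of_mx A) = A.
Proof.
apply/matrixP => i j; rewrite !mxE.
have -> : (inord (@inord 7 (4 * i + 2 * j) %/ 4) : 'I_2) = i.
  by apply: val_inj; case: i j => -[|[|//]] ? [[|[|//]] ?]; rewrite /= !inordK.
have -> : (inord (@inord 7 (4 * i + 2 * j + 1) %/ 4) : 'I_2) = i.
  by apply: val_inj; case: i j => -[|[|//]] ? [[|[|//]] ?]; rewrite /= !inordK.
have -> : (inord (@inord 7 (4 * i + 2 * j) %% 4 %/ 2) : 'I_2) = j.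
  by apply: val_inj; case: i j => -[|[|//]] ? [[|[|//]] ?]; rewrite /= !inordK.
have -> : (inord (@inord 7 (4 * i + 2 * j + 1) %% 4 %/ 2) : 'I_2) = j.
  by apply: val_inj; case: i j => -[|[|//]] ? [[|[|//]] ?]; rewrite /= !inordK.
have -> : odd (@inord 7 (4 * i + 2 * j)) = false.
  by case: i j => -[|[|//]] ? [[|[|//]] ?]; rewrite /= !inordK.
have -> : odd (@inord 7 (4 * i + 2 * j + 1)) = true.
  by case: i j => -[|[|//]] ? [[|[|//]] ?]; rewrite /= !inordK.
by case: (A i j).
Qed.

Lemma continuous_mnorm_coords : continuous (fun v : 'rV[R]_8 => N (mx_of_coords v)).
Proof.
have [K K0 HK] := mnorm_le_entries.
have bd v : N (mx_of_coords v) <= K * (2 * `|v|).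
  apply: HK => i j; rewrite mxE.
  set u1 := v _ _; set u2 := v _ _.
  have h1 : `|u1| <= `|v| by exact: coord_le_norm.
  have h2 : `|u2| <= `|v| by exact: coord_le_norm.
  have -> : Complex u1 u2 = Complex u1 0 + Complex 0 u2.
    by apply/eqP; rewrite eq_complex /= addr0 add0r !eqxx.
  apply: le_trans (le_normcD _ _) _.
  rewrite /normc !expr0n /= addr0 add0r !sqrtr_sqr; lra.
have lip v w : N (mx_of_coords v) <= N (mx_of_coords w) + K * (2 * `|v - w|).
  have e1 : mx_of_coords v = mx_of_coords (v - w) + mx_of_coords w.
    by have := mx_of_coords_linear 1 (v - w) w; rewrite !scale1r subrK.
  rewrite [X in N X <= _]e1; apply: le_trans (mnorm_triangle _ _) _.
  by rewrite [X in X <= _]addrC lerD2l; exact: bd.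
move=> v; apply/(@cvgrPdist_le _ _ _ (nbhs v) (nbhs_filter v)) => /= eps eps0.
have FF : Filter (nbhs v) := nbhs_filter v.
near=> w.
have h : `|v - w| <= eps / (K * 2).
  by near: w; apply: cvgr_dist_le; rewrite ?divr_gt0 ?mulr_gt0 //; exact: cvg_id.
rewrite ler_pdivlMr ?mulr_gt0 // in h.
have := lip v w; have := lip w v; rewrite (distrC w v) ler_norml; lra.
Unshelve. all: by end_near.
Qed.

Lemma mx_of_coordsK v : coords_of_mx (mx_of_coords v) = v.
Proof.
apply/rowP => k; rewrite !mxE.
by case: k => -[|[|[|[|[|[|[|[|//]]]]]]]] hk; rewrite /= !inordK //=;
   congr (v 0 _); apply: val_inj; rewrite /= inordK.
Qed.

(** The norm is continuous and positive on the unit sphere, which is compact, so it is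
bounded below there. *)
Lemma entries_le_mnorm : exists2 K : R, 0 < K &
  forall (A : 'M[C]_2) i j, normc (A i j) <= K * N A.
Proof.
pose S := [set v : 'rV[R]_8 | `|v| = 1].
have S0 : S !=set0.
  have nz : (const_mx 1 : 'rV[R]_8) != 0.
    by apply/eqP => /rowP/(_ 0); rewrite !mxE => /eqP; rewrite oner_eq0.
  exists (`|const_mx 1 : 'rV[R]_8|^-1 *: const_mx 1).
  by rewrite /S /= normrZ normfV normr_id mulVf // normr_eq0.
have cS : compact S.
  apply: bounded_closed_compact.
    exists 1; split => // M M1 v /= ->; exact: ltW.
  apply: (@closed_comp _ _ (fun v : 'rV[R]_8 => `|v|) [set 1]); last exact: closed_eq.
  by move=> v _; exact: norm_continuous.
have [c cS1 cmin] := EVT_min_rV S0 cS (continuous_subspaceT continuous_mnorm_coords).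
set d := N (mx_of_coords c) in cmin.
have d0 : 0 < d.
  rewrite lt_def mnorm_ge0 andbT; apply/eqP => h.
  have [h0 _ _] := Nnorm; have {}h := h0 _ h.
  have c0 : c = 0.
    rewrite -(mx_of_coordsK c) h; apply/rowP => k; rewrite !mxE.
    by rewrite /= ?mxE; case: (odd _).
  by move: cS1; rewrite inE /S /= c0 normr0 => /eqP; rewrite eq_sym oner_eq0.
exists (2 / d); first by rewrite divr_gt0.
move=> A i j; set v := coords_of_mx A.
have vd : d * `|v| <= N A.
  have [->|v0] := eqVneq v 0; first by rewrite normr0 mulr0 mnorm_ge0.
  have nv : 0 < `|v| by rewrite normr_gt0.
  have vS : (`|v|^-1 *: v) \in S.
    by rewrite inE /S /= normrZ normfV normr_id mulVf // gt_eqF.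
  have := cmin _ vS.
  have := mx_of_coords_linear (`|v|^-1) v 0; rewrite addr0 => ->.
  have -> : mx_of_coords 0 = 0.
    by apply/matrixP => r s; rewrite !mxE.
  rewrite addr0 mnormZ coords_of_mxK /normc /= expr0n addr0 sqrtr_sqr ger0_norm ?invr_ge0 //.
  by rewrite ler_pdivlMl // mulrC.
have : normc (A i j) <= 2 * `|v|.
  rewrite -(coords_of_mxK A) mxE -/v.
  set u1 := v _ _; set u2 := v _ _.
  have h1 : `|u1| <= `|v| by exact: coord_le_norm.
  have h2 : `|u2| <= `|v| by exact: coord_le_norm.
  have -> : Complex u1 u2 = Complex u1 0 + Complex 0 u2.
    by apply/eqP; rewrite eq_complex /= addr0 add0r !eqxx.
  apply: le_trans (le_normcD _ _) _.
  rewrite /normc !expr0n /= addr0 add0r !sqrtr_sqr; lra.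
move=> h; apply: (le_trans h); rewrite -mulrA ler_pM2l // ler_pdivlMl //.
Qed.
End NormComparison.

(** * Simultaneous triangularization of the cocycle *)

Local Arguments normc : simpl never.

Section CocycleStructure.
Variables (R : realType) (q : nat) (zeta : 'I_2 -> seq 'I_2).
Hypothesis cl : constant_length zeta q.
Local Notation C := R[i].

Lemma sum_count_mem (m : nat) (s : seq 'I_m) : (\sum_(a : 'I_m) count_mem a s = size s)%N.
Proof.
elim: s => [|c s IH] /=; first by rewrite big1.
by rewrite big_split /= IH (bigD1 c) //= eqxx big1 ?addn0 // => a; rewrite eq_sym => /negbTE ->.
Qed.

Lemma subst_matrix_const (t : R) :
  (map_mx (fun i : nat => i%:R) (subst_matrix zeta))^T *m const_mx t =
  const_mx (q%:R * t) :> 'cV[R]_2.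
Proof.
apply/matrixP => i j; rewrite !mxE.
rewrite (eq_bigr (fun k : 'I_2 => (count_mem k (zeta i))%:R * t)) => [|k _]; last by rewrite !mxE.
by rewrite -mulr_suml -natr_sum sum_count_mem cl.
Qed.

Lemma subst_matrixX_const (t : R) k :
  (map_mx (fun i : nat => i%:R) (subst_matrix zeta))^T ^+ k *m const_mx t =
  const_mx (q%:R ^+ k * t) :> 'cV[R]_2.
Proof.
elim: k => [|k IH]; first by rewrite expr0 mul1mx mul1r.
by rewrite exprS -[X in X *m _]/(_ *m _) -mulmxA IH subst_matrix_const mulrA -exprS.
Qed.

(** The one-step matrix at the point [(t, t)] of the diagonal. *)
Definition step_mx t : 'M[C]_2 := cocycle1 zeta (const_mx t).

Lemma cocycle_constS (w : R) k :
  cocycle zeta (const_mx w) k.+1 = step_mx (q%:R ^+ k * w) *m cocycle zeta (const_mx w) k.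
Proof. by rewrite /= subst_matrixX_const. Qed.

Lemma step_mxE t a b : step_mx t a b = \sum_(j < q) (nth a (zeta a) j == b)%:R * e (j%:R * t).
Proof.
rewrite /step_mx mxE.
rewrite (eq_bigr (fun j : 'I_(size (zeta a)) => (nth a (zeta a) j == b)%:R * e (j%:R * t))); last first.
  move=> j _; congr (_ * e _).
  rewrite (eq_bigr (fun=> t)) => [|c _]; last by rewrite mxE.
  rewrite big_const_seq count_predT size_takel; last exact: ltnW (ltn_ord j).
  by rewrite iter_addr_0 mulr_natl.
by rewrite -(big_mkord xpredT (fun j => (nth a (zeta a) j == b)%:R * e (j%:R * t))) cl big_mkord.
Qed.

Definition dirichlet t : C := \sum_(j < q) e (j%:R * t).

Lemma step_mx_rowsum t a : step_mx t a 0 + step_mx t a 1 = dirichlet t.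
Proof.
rewrite !step_mxE -big_split; apply: eq_bigr => j _ /=.
rewrite -mulrDl; have -> : ((nth a (zeta a) j == 0)%:R + (nth a (zeta a) j == 1)%:R = 1 :> C).
  by case: (nth _ _ _) => -[|[|//]] h; rewrite /eq_op /= ?add0r ?addr0.
by rewrite mul1r.
Qed.

(** This is what makes the product of the kernels along an orbit telescope. *)
Lemma dirichletE t : (e t - 1) * dirichlet t = e (q%:R * t) - 1.
Proof.
rewrite eMn subrX1 /dirichlet; congr (_ * _); apply: eq_bigr => j _.
by rewrite eMn.
Qed.

(** The difference of the indicator polynomials of the second letter in the two
words; its value at [e(t)] is the eigenvalue of [step_mx t] on the row vector
[(-1, 1)]. *)
Definition diff_poly : {poly C} :=
  \poly_(j < q) ((nth 1 (zeta 1) j == 1)%:R - (nth 0 (zeta 0) j == 1)%:R).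

Lemma diff_polyE t : step_mx t 1 1 - step_mx t 0 1 = diff_poly.[e t].
Proof.
rewrite /diff_poly horner_poly !step_mxE -sumrB; apply: eq_bigr => j _.
by rewrite mulrBl eMn.
Qed.

Lemma diff_poly_lead : zeta 0 != zeta 1 -> normc (lead_coef diff_poly) = 1.
Proof.
move=> nz.
have p0 : diff_poly != 0.
  apply: contra nz => /eqP p0; apply/eqP.
  apply: (@eq_from_nth _ 0); first by rewrite !cl.
  move=> j; rewrite cl => jq.
  have : diff_poly`_j = 0 by rewrite p0 coef0.
  rewrite coef_poly jq (set_nth_default 0 1) ?cl // => /eqP.
  rewrite subr_eq0 eqr_nat.
  by case: (nth 0 (zeta 1) j) => -[|[|//]] h1; case: (nth 0 (zeta 0) j) => -[|[|//]] h0 //= _; apply: val_inj.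
have : lead_coef diff_poly != 0 by rewrite lead_coef_eq0.
rewrite lead_coefE coef_poly; case: ifP => _; last by rewrite eqxx.
case: (_ == 1); case: (_ == 1); rewrite ?subrr ?eqxx // ?subr0 ?sub0r => _.
  exact: normc1.
by rewrite normcN normc1.
Qed.

Section Orbit.
Variable w : R.
Local Notation t k := (q%:R ^+ k * w).
Local Notation A n := (cocycle zeta (const_mx w) n).
Definition gap k : C := e (t k) - 1.
Definition diff_prod n : C := \prod_(0 <= k < n) diff_poly.[e (t k)].
Local Notation E := gap.
Local Notation delta := diff_prod.

Lemma cocycle_entryS n i j : A n.+1 i j = step_mx (t n) i 0 * A n 0 j + step_mx (t n) i 1 * A n 1 j.
Proof.
by rewrite cocycle_constS mxE !big_ord_recl big_ord0 addr0; congr (_ + _ * A n _ _);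
  [congr (step_mx _ _ _) |]; apply: val_inj.
Qed.

(** The row vector [(-1, 1)] is a left eigenvector of every factor. *)
Lemma cocycle_left_eigen n : A n 1 1 - A n 0 1 = delta n /\ A n 0 0 - A n 1 0 = delta n.
Proof.
elim: n => [|n [IH1 IH2]].
  by rewrite /diff_prod /= !mxE big_nil /= !subr0.
have h := step_mx_rowsum (t n); rewrite !cocycle_entryS /diff_prod big_nat_recr //= -/(diff_prod n) -diff_polyE.
have h0 : step_mx (t n) 0 0 = dirichlet (t n) - step_mx (t n) 0 1 by rewrite -(h 0) addrK.
have h1 : step_mx (t n) 1 0 = dirichlet (t n) - step_mx (t n) 1 1 by rewrite -(h 1) addrK.
split; first by rewrite -IH1 h0 h1; ring.
by rewrite -IH2 h0 h1; ring.
Qed.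

(** The column vector [(1, 1)] is a right eigenvector of every factor; multiplying by
[gap 0] avoids a division in the telescoped eigenvalue. *)
Lemma cocycle_rowsum n : (A n 0 0 + A n 0 1) * E 0 = E n /\ (A n 1 0 + A n 1 1) * E 0 = E n.
Proof.
elim: n => [|n [IH1 IH2]].
  by rewrite /= !mxE /= addr0 add0r mul1r.
have h := step_mx_rowsum (t n); rewrite !cocycle_entryS.
have EE : E n.+1 = E n * dirichlet (t n) by rewrite /gap dirichletE exprS mulrA.
have h0 : step_mx (t n) 0 0 = dirichlet (t n) - step_mx (t n) 0 1 by rewrite -(h 0) addrK.
have h1 : step_mx (t n) 1 0 = dirichlet (t n) - step_mx (t n) 1 1 by rewrite -(h 1) addrK.
rewrite EE h0 h1.
have hE : A n 1 0 * E 0 = E n - A n 1 1 * E 0 by rewrite -IH2; ring.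
have hE0 : A n 0 0 * E 0 = E n - A n 0 1 * E 0 by rewrite -IH1; ring.
split.
  transitivity ((dirichlet (t n) - step_mx (t n) 0 1) * (A n 0 0 * E 0 + A n 0 1 * E 0)
     + step_mx (t n) 0 1 * (A n 1 0 * E 0 + A n 1 1 * E 0)); first by ring.
  by rewrite hE hE0; ring.
transitivity ((dirichlet (t n) - step_mx (t n) 1 1) * (A n 0 0 * E 0 + A n 0 1 * E 0)
   + step_mx (t n) 1 1 * (A n 1 0 * E 0 + A n 1 1 * E 0)); first by ring.
by rewrite hE hE0; ring.
Qed.

Lemma cocycle01S n : A n.+1 0 1 = dirichlet (t n) * A n 0 1 + step_mx (t n) 0 1 * delta n.
Proof.
have [<- _] := cocycle_left_eigen n; rewrite cocycle_entryS -(step_mx_rowsum (t n) 0); ring.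
Qed.

Lemma normc_step_mx_le a b s : normc (step_mx s a b) <= q%:R.
Proof.
rewrite step_mxE.
have ns (F : 'I_q -> C) : normc (\sum_j F j) <= \sum_j normc (F j).
  elim/big_ind2 : _ => //; first by rewrite normc0.
  by move=> x u y v h1 h2; apply: le_trans (le_normcD _ _) _; exact: lerD.
apply: le_trans (ns _) _.
apply: (@le_trans _ _ (\sum_(j < q) 1)); last by rewrite sumr_const card_ord.
apply: ler_sum => j _; rewrite normcM normc_e mulr1.
by case: (_ == b); rewrite ?normc0 ?normc1.
Qed.

Hypothesis Enz : forall k, E k != 0.

Lemma normcE_gt0 k : 0 < normc (E k). Proof. exact: normc_gt0. Qed.

Lemma normcE_le2 k : normc (E k) <= 2.
Proof.
by apply: le_trans (le_normcD _ _) _; rewrite normcN normc1 normc_e.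
Qed.

(** The recursion [cocycle01S] becomes additive after division by [gap n], because the
Dirichlet kernel is the quotient of consecutive gaps. *)
Lemma normc_cocycle01_le n :
  normc (A n 0 1) <= normc (E n) * \sum_(0 <= k < n) q%:R * (normc (delta k) / normc (E k.+1)).
Proof.
elim: n => [|n IH]; first by rewrite big_nil mulr0 /= mxE -[X in normc X]/(0 : C) normc0.
rewrite cocycle01S big_nat_recr //= mulrDr.
apply: le_trans (le_normcD _ _) _; rewrite !normcM; apply: lerD.
  have EE : E n.+1 = E n * dirichlet (t n) by rewrite /gap dirichletE exprS mulrA.
  by rewrite EE normcM [normc (E n) * _]mulrC -mulrA ler_wpM2l // normc_ge0.
rewrite mulrCA [normc (E _) * _]mulrC mulfVK ?gt_eqF ?normcE_gt0 //.
by rewrite ler_wpM2r ?normc_ge0 // normc_step_mx_le.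
Qed.

(** All the entries are combinations of the common row sum, of the upper right entry
and of the eigenvalue [diff_prod]. *)
Lemma normc_cocycle_le n i j :
  normc (A n i j) <= 2 / normc (E 0)
    + 2 * q%:R * \sum_(0 <= k < n) (normc (delta k) / normc (E k.+1)) + normc (delta n).
Proof.
have E0p := normcE_gt0 0.
pose s := A n 0 0 + A n 0 1.
have sE : normc s <= 2 / normc (E 0).
  have [h _] := cocycle_rowsum n.
  by rewrite ler_pdivlMr // -normcM h normcE_le2.
set b := A n 0 1; set d := delta n.
set T := \sum_(0 <= k < n) _.
have T0 : 0 <= T.
  by apply: sumr_ge0 => k _; rewrite divr_ge0 // normc_ge0.
have bE : normc b <= 2 * q%:R * T.
  apply: le_trans (normc_cocycle01_le n) _; rewrite -mulr_sumr -mulrA.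
  by rewrite ler_wpM2r ?normcE_le2 // mulr_ge0.
have [h1 h2] := cocycle_left_eigen n.
have d0 := normc_ge0 d.
have b0 := normc_ge0 b.
have s0 := normc_ge0 s.
have A00 : A n 0 0 = s + - b by rewrite /s /b addrK.
have A11 : A n 1 1 = b + d by rewrite /d -h1 /b addrC subrK.
have A10 : A n 1 0 = s + - b + - d.
  by rewrite -A00 /d -h2 opprB addrC subrK.
have c2 (x : 'I_2) : x = 0 \/ x = 1.
  by case: x => -[|[|//]] h; [left | right]; apply: val_inj.
have tri := @le_normcD R.
have [-> | ->] := c2 i; have [-> | ->] := c2 j.
- rewrite A00; apply: le_trans (tri _ _) _; rewrite normcN; lra.
- have : 0 <= 2 / normc (E 0) by apply: le_trans sE.
  by rewrite -/b; lra.
- rewrite A10; apply: le_trans (tri _ _) _; apply: le_trans (lerD (tri _ _) (lexx _)) _.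
  rewrite !normcN; lra.
- have : 0 <= 2 / normc (E 0) by apply: le_trans sE.
  by rewrite A11 => ?; apply: le_trans (tri _ _) _; lra.
Qed.

Lemma normc_diff_prod_le n (M : R) : (forall i j, normc (A n i j) <= M) ->
  normc (delta n) <= 2 * M.
Proof.
move=> AM; have [<- _] := cocycle_left_eigen n.
apply: le_trans (le_normcD _ _) _; rewrite normcN.
by have := AM 1 1; have := AM 0 1; lra.
Qed.

End Orbit.
End CocycleStructure.

(** * Growth of the cocycle *)

Section Rate.
Variable R : realType.
Local Notation rate := (lil_rate R).

Lemma ln4_ge1 : 1 <= ln 4 :> R. Proof. exact: ln_ge1. Qed.

Lemma le_lil_rate (k n : nat) : (4 <= k)%N -> (k <= n)%N -> rate k <= rate n.
Proof.
move=> k4 kn; apply: ler_wsqrtr.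
have k4R : 4 <= k%:R :> R by rewrite ler_nat.
have knR : k%:R <= n%:R :> R by rewrite ler_nat.
have lk : 1 <= ln k%:R :> R by exact: ln_ge1.
have lkn : ln k%:R <= ln n%:R :> R by rewrite ler_ln ?posrE //; lra.
apply: ler_pM => //; first by rewrite ln_ge0.
by rewrite ler_ln ?posrE //; lra.
Qed.

Lemma lil_rateS (n : nat) : (16 <= n)%N -> rate n.+1 <= 2 * rate n.
Proof.
move=> n16.
have nR : 16 <= n%:R :> R by rewrite ler_nat.
have nS : n.+1%:R = n%:R + 1 :> R by rewrite natr1.
have l16 : 2 <= ln n%:R :> R.
  apply: (@le_trans _ _ (ln (4 ^+ 2))).
    by rewrite lnXn // -mulr_natl; have := ln4_ge1; lra.
  by rewrite ler_ln ?posrE; lra.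
have -> : 2 * rate n = Num.sqrt (4 * (n%:R * ln (ln n%:R))).
  rewrite [RHS]sqrtrM // (_ : 4 = 2 ^+ 2 :> R); last by ring.
  by rewrite sqrtr_sqr ger0_norm.
apply: ler_wsqrtr; rewrite nS.
have -> : 4 * (n%:R * ln (ln n%:R)) = (2 * n%:R) * (2 * ln (ln n%:R)) :> R by ring.
have lS : ln (n%:R + 1) <= 2 * ln n%:R :> R.
  have -> : 2 * ln n%:R = ln (n%:R * n%:R) :> R by rewrite lnM ?posrE //; [ring | lra | lra].
  by rewrite ler_ln ?posrE //; nra.
have lS1 : 1 <= ln (n%:R + 1) :> R by apply: ln_ge1; lra.
apply: ler_pM; [by lra | by rewrite ln_ge0 | by lra |].
have -> : 2 * ln (ln n%:R) = ln (ln n%:R * ln n%:R) :> R by rewrite lnM ?posrE //; [ring | lra | lra].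
by rewrite ler_ln ?posrE //; nra.
Qed.

Lemma sqrt_le_lil_rate (n : nat) : (256 <= n)%N -> Num.sqrt n%:R <= rate n.
Proof.
move=> n256.
have nR : 256 <= n%:R :> R by rewrite ler_nat.
have l256 : 4 <= ln n%:R :> R.
  apply: (@le_trans _ _ (ln (4 ^+ 4))).
    rewrite lnXn // -[ln 4 *+ 4]mulr_natl; have := ln4_ge1; lra.
  by rewrite ler_ln ?posrE; [rewrite -natrX ler_nat | rewrite -natrX ltr0n | lra].
apply: ler_wsqrtr.
have : 1 <= ln (ln n%:R) :> R by exact: ln_ge1.
by nra.
Qed.

(** From [n >= 256] on, [ln (ln n) >= 1], so the rate is at least [sqrt n], and the
exponential of [sqrt n] is at least [n^2 / 256]. *)
Lemma lil_rate_dominates (c1 c2 : R) : 0 <= c1 -> 0 <= c2 ->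
  exists n0 : nat, forall n, (n0 <= n)%N -> c1 + c2 * n%:R <= expR (rate n).
Proof.
move=> c10 c20.
exists (maxn 256 (Num.truncn (256 * (c1 + c2))).+1) => n.
rewrite geq_max => /andP[n256 nc].
have hc : 256 * (c1 + c2) <= n%:R.
  have p0 : 0 <= 256 * (c1 + c2) by apply: mulr_ge0; [lra | exact: addr_ge0].
  have /andP[_ /ltW h] := truncn_itv p0.
  by apply: le_trans h _; rewrite ler_nat.
have n0 : 256 <= n%:R :> R by rewrite ler_nat.
have n00 : 0 <= n%:R :> R by [].
set s := Num.sqrt n%:R : R.
have s0 : 0 <= s by exact: sqrtr_ge0.
have ss : s * s = n%:R by rewrite -expr2 sqr_sqrtr.
apply: (@le_trans _ _ (expR s)); last by rewrite ler_expR; exact: sqrt_le_lil_rate.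
have h4 : (1 + s / 4) ^+ 4 <= expR s.
  rewrite {2}(_ : s = 4%:R * (s / 4)); last by field.
  rewrite expRM_natl lerXn2r ?nnegrE ?expR_ge0 ?addr_ge0 ?divr_ge0 //.
  exact: expR_ge1Dx.
apply: le_trans h4.
have h2 : n%:R / 16 <= (1 + s / 4) ^+ 2.
  rewrite -ss expr2; nra.
apply: (@le_trans _ _ ((n%:R / 16) ^+ 2)).
  have : (c1 + c2) * n%:R <= n%:R / 256 * n%:R by rewrite ler_wpM2r //; lra.
  rewrite expr2; nra.
have -> : (1 + s / 4) ^+ 4 = ((1 + s / 4) ^+ 2) ^+ 2 by rewrite -exprM.
rewrite ler_sqr ?nnegrE ?divr_ge0 //.
by rewrite exprn_ge0 // addr_ge0 // divr_ge0.
Qed.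

Lemma lil_rate_small (eps : R) : 0 < eps ->
  exists n0 : nat, forall n, (n0 <= n)%N -> rate n <= eps * n%:R.
Proof.
move=> eps0.
exists (maxn 256 (Num.truncn (4 / eps ^+ 4)).+1) => n.
rewrite geq_max => /andP[n256 nc].
have hc : 4 / eps ^+ 4 <= n%:R.
  have p0 : 0 <= 4 / eps ^+ 4 by rewrite divr_ge0 // exprn_ge0 // ltW.
  have /andP[_ /ltW h] := truncn_itv p0.
  by apply: le_trans h _; rewrite ler_nat.
have n0 : 256 <= n%:R :> R by rewrite ler_nat.
set s := Num.sqrt n%:R : R.
have s0 : 0 < s by rewrite sqrtr_gt0; lra.
have ss : s ^+ 2 = n%:R by rewrite sqr_sqrtr.
have ln0 : 0 < ln n%:R :> R by rewrite ln_gt0; lra.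
have lln : ln (ln n%:R) <= 2 * s.
  have h1 : ln (ln n%:R) <= ln n%:R :> R by rewrite ltW // ln_sublinear.
  have h2 : ln n%:R = 2 * ln s :> R by rewrite -ss lnXn // -[ln s *+ 2]mulr_natl.
  have h3 : ln s <= s by rewrite ltW // ln_sublinear.
  lra.
have -> : eps * n%:R = Num.sqrt ((eps * n%:R) ^+ 2).
  by rewrite sqrtr_sqr ger0_norm // mulr_ge0 // ltW.
apply: ler_wsqrtr.
have hs : 2 <= eps ^+ 2 * s.
  rewrite -ler_sqr ?nnegrE //; last by apply: mulr_ge0 (sqr_ge0 _) (ltW s0).
  have -> : (eps ^+ 2 * s) ^+ 2 = n%:R * eps ^+ 4 :> R by rewrite exprMn ss; ring.
  have -> : 2 ^+ 2 = 4 :> R by ring.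
  by rewrite -ler_pdivrMr ?exprn_gt0.
have -> : (eps * n%:R) ^+ 2 = n%:R * (eps ^+ 2 * s * s) :> R.
  by rewrite -(mulrA _ s s) -[s * s]expr2 ss; ring.
rewrite ler_wpM2l //; apply: (le_trans lln).
by rewrite ler_wpM2r // ltW.
Qed.
End Rate.

Section LimSup.
Variable R : realType.
Local Notation rate := (lil_rate R).

(** The fluctuations [sqrt(n ln ln n)] are negligible with respect to [n], so the
normalized logarithms converge. *)
Lemma limn_esup_exponent (a : nat -> R) (I B : R) :
  (exists2 n0 : nat, (0 < n0)%N & forall n, (n0 <= n)%N ->
     expR (- (B * rate n)) <= a n / expR (n%:R * I) <= expR (B * rate n)) ->
  limn_esup (fun n : nat => (((n%:R)^-1)%:E * lne (a n)%:E)%E) = I%:E.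
Proof.
move=> [n0 n00 h].
suff cv : (fun n : nat => (((n%:R)^-1)%:E * lne (a n)%:E)%E) @ \oo --> I%:E.
  by rewrite is_cvg_limn_esupE ?(cvg_lim _ cv) //; apply/cvg_ex; exists I%:E.
have eqn n : (n0 <= n)%N -> (((n%:R)^-1)%:E * lne (a n)%:E = (n%:R^-1 * ln (a n))%:E)%E /\
     `|ln (a n) - n%:R * I| <= B * rate n.
  move=> /h; rewrite ler_pdivlMr ?expR_gt0 // ler_pdivrMr ?expR_gt0 // -!expRD => /andP[h1 h2].
  have a0 : 0 < a n by apply: lt_le_trans h1; exact: expR_gt0.
  split; first by rewrite lne_EFin.
  have h3 : - (B * rate n) + n%:R * I <= ln (a n) by rewrite -ler_expR lnK.
  have h4 : ln (a n) <= B * rate n + n%:R * I by rewrite -ler_expR lnK.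
  by rewrite ler_norml; lra.
apply: (@cvg_trans _ ((fun n : nat => (n%:R^-1 * ln (a n))%:E) @ \oo)).
  apply: near_eq_cvg; near=> n.
  have nn0 : (n0 <= n)%N by near: n; exact: nbhs_infty_ge.
  by have [-> _] := eqn n nn0.
apply: cvg_EFin; first exact: nearW.
apply/cvgrPdist_le => eps eps0.
have B1 : 0 < `|B| + 1 by rewrite ltr_wpDl.
have [n1 hn1] := lil_rate_small (divr_gt0 eps0 B1).
near=> n.
have nn0 : (n0 <= n)%N by near: n; exact: nbhs_infty_ge.
have nn1 : (n1 <= n)%N by near: n; exact: nbhs_infty_ge.
have npos : 0 < n%:R :> R by rewrite ltr0n (leq_trans n00).
have [_ hd] := eqn n nn0.
have {}hn1 := hn1 n nn1.
rewrite /= distrC -(ler_pM2l npos) -{1}(ger0_norm (ltW npos)) -normrM mulrBr mulrA divff ?gt_eqF // mul1r.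
apply: (le_trans hd).
have r0 := @lil_rate_ge0 R n.
have h5 : B * rate n <= (`|B| + 1) * rate n.
  by rewrite ler_wpM2r //; have := ler_norm B; lra.
apply: (le_trans h5); move: hn1; rewrite mulrAC ler_pdivlMr //; lra.
Unshelve. all: by end_near.
Qed.
End LimSup.

Section Growth.
Variables (R : realType) (q : nat) (zeta : 'I_2 -> seq 'I_2) (N : 'M[R[i]]_2 -> R).
Hypotheses (q2 : (2 <= q)%N) (cl : constant_length zeta q) (Nnorm : is_matrix_norm N).
Local Notation C := R[i].
Local Notation rate := (lil_rate R).
Local Notation p := (diff_poly R q zeta).

(** The lower bound uses that [D_n] is a linear functional of the matrix.  In the
upper bound, [e^(kI) <= e^(nI)] for [k <= n] since [I >= 0], and the polynomial
and [w]-dependent factors are absorbed by one extra unit in the coefficient of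
the rate. *)
Lemma cocycle_growth (w I B1 B2 : R) : 0 <= I -> 0 < B1 -> 0 < B2 ->
  (forall j, p.[e (q%:R ^+ j * w)] != 0) ->
  (forall j, e (q%:R ^+ j * w) != 1 :> C) ->
  (exists n1 : nat, forall n, (n1 <= n)%N ->
     `|\sum_(0 <= j < n) ln (normc p.[e (q%:R ^+ j * w)]) - n%:R * I| <= B1 * rate n) ->
  (exists n2 : nat, forall n, (n2 <= n)%N ->
     `|\sum_(0 <= j < n) lnd 1 (q%:R ^+ j * w)| <= B2 * rate n) ->
  exists2 n0 : nat, (0 < n0)%N & forall n, (n0 <= n)%N ->
    expR (- ((B1 + 3 * B2 + 1) * rate n))
      <= N (cocycle zeta (const_mx w) n) / expR (n%:R * I)
      <= expR ((B1 + 3 * B2 + 1) * rate n).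
Proof.
move=> I0 B10 B20 pnz enz [n1 h1] [n2 h2].
have Enz k : gap q w k != 0 by rewrite subr_eq0; exact: enz.
pose D k := normc (diff_prod q zeta w k).
pose G k := normc (gap q w k).
have DE k : D k = expR (\sum_(0 <= j < k) ln (normc p.[e (q%:R ^+ j * w)])).
  rewrite /D /diff_prod normc_prod expR_sum; apply: eq_bigr => j _.
  by rewrite lnK // posrE; exact: normc_gt0.
have GE k : G k = expR (lnd 1 (q%:R ^+ k * w)).
  by rewrite /lnd lnK // posrE; exact: normc_gt0 (Enz k).
pose m := maxn (maxn n1 n2) 16.
have [mn1 mn2 m16] : [/\ n1 <= m, n2 <= m & 16 <= m]%N by rewrite /m; split; lia.
have Dup k : (m <= k)%N -> D k <= expR (k%:R * I + B1 * rate k).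
  move=> mk; rewrite DE ler_expR; have := h1 k (leq_trans mn1 mk).
  by rewrite ler_norml; lra.
have Dlo k : (m <= k)%N -> expR (k%:R * I - B1 * rate k) <= D k.
  move=> mk; rewrite DE ler_expR; have := h1 k (leq_trans mn1 mk).
  by rewrite ler_norml; lra.
have Glo k : (m <= k)%N -> expR (- (B2 * (rate k + rate k.+1))) <= G k.
  move=> mk; rewrite GE ler_expR.
  have := h2 k (leq_trans mn2 mk); have := h2 k.+1 (leq_trans mn2 (leqW mk)).
  by rewrite big_nat_recr //= !ler_norml; lra.
pose a k := D k / G k.+1.
have G0 k : 0 < G k by exact: normc_gt0.
have D0 k : 0 <= D k by exact: normc_ge0.
have a0 k : 0 <= a k by rewrite divr_ge0 // ltW.
pose A0 := \sum_(0 <= k < m) a k.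
have A00 : 0 <= A0 by exact: sumr_ge0.
pose B4 := B1 + 3 * B2.
have ale n k : (m <= k)%N -> (k < n)%N -> a k <= expR (n%:R * I + B4 * rate n).
  move=> mk kn.
  have n16 : (16 <= n)%N by rewrite (leq_trans m16) // (leq_trans mk) // ltnW.
  have k4 : (4 <= k)%N by rewrite (leq_trans _ mk) // (leq_trans _ m16).
  have r1 := @le_lil_rate R k n k4 (ltnW kn).
  have r2 := @le_lil_rate R k.+1 n (leqW k4) kn.
  (* The index [k + 2] may exceed [n] by one, hence the factor [2]. *)
  have r3 : rate k.+2 <= 2 * rate n.
    by apply: le_trans (lil_rateS R n16); apply: le_lil_rate; rewrite ?ltnS ?(leqW k4) //; lia.
  rewrite /a ler_pdivrMr //.
  apply: le_trans (Dup k mk) _.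
  apply: (@le_trans _ _ (expR (n%:R * I + B4 * rate n) * expR (- (B2 * (rate k.+1 + rate k.+2))))); last first.
    by rewrite ler_wpM2l ?expR_ge0 // Glo // leqW.
  rewrite -expRD ler_expR.
  have kI : k%:R * I <= n%:R * I by rewrite ler_wpM2r // ler_nat ltnW.
  have b1 : B1 * rate k <= B1 * rate n by rewrite ler_pM2l.
  have b2 : B2 * (rate k.+1 + rate k.+2) <= B2 * (3 * rate n) by rewrite ler_pM2l //; lra.
  rewrite /B4; lra.
have [K K0 HK] := mnorm_le_entries Nnorm.
have [K' K'0 HK'] := entries_le_mnorm Nnorm.
pose c1 := K * (2 / G 0%N + 2 * q%:R * A0 + 1).
pose c2 := K * (2 * q%:R).
have q0 : 0 <= q%:R :> R by [].
have g0 : 0 <= 2 / G 0%N by rewrite divr_ge0 // ltW.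
have qA0 : 0 <= 2 * q%:R * A0 by rewrite !mulr_ge0.
have c10 : 0 <= c1 by rewrite /c1; apply: mulr_ge0; lra.
have c20 : 0 <= c2 by rewrite /c2; apply: mulr_ge0; lra.
have [n3 h3] := lil_rate_dominates c10 c20.
have [n4 h4] := @lil_rate_dominates R (2 * K') 0 (ltW (mulr_gt0 (ltr0Sn _ 1) K'0)) (lexx 0).
exists (maxn (maxn m n3) n4).
  by apply: (leq_trans _ (leq_trans m16 _)); rewrite // -maxnA leq_maxl.
move=> n; rewrite geq_max => /andP[]; rewrite geq_max => /andP[mn n3n] n4n.
have n16 := leq_trans m16 mn.
have rn0 := @lil_rate_ge0 R n.
set A := cocycle _ _ _.
have eB4 : 1 <= expR (n%:R * I + B4 * rate n).
  rewrite -expR0 ler_expR addr_ge0 ?mulr_ge0 //.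
  by rewrite /B4; lra.
set L := expR (n%:R * I + B4 * rate n) in eB4.
have sumle : \sum_(0 <= k < n) a k <= A0 + n%:R * L.
  rewrite (big_cat_nat (leq0n m) mn) /= lerD2l.
  apply: (@le_trans _ _ (\sum_(m <= k < n) L)).
    by apply: ler_sum_nat => k /andP[mk kn]; exact: ale.
  rewrite sumr_const_nat -[L *+ _]mulr_natl ler_wpM2r ?expR_ge0 //.
  by rewrite ler_nat leq_subr.
have entries i j : normc (A i j) <= (2 / G 0%N + 2 * q%:R * A0 + 1 + 2 * q%:R * n%:R) * L.
  apply: le_trans (normc_cocycle_le cl Enz n i j) _.
  have dn : D n <= L.
    by apply: le_trans (Dup n mn) _; rewrite ler_expR /B4 lerD2l ler_wpM2r //; lra.
  have s1 : 2 * q%:R * (\sum_(0 <= k < n) a k) <= 2 * q%:R * (A0 + n%:R * L).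
    by rewrite ler_wpM2l // mulr_ge0.
  have s2 : (2 / G 0%N) * 1 <= (2 / G 0%N) * L by rewrite ler_wpM2l.
  have s3 : (2 * q%:R * A0) * 1 <= (2 * q%:R * A0) * L by rewrite ler_wpM2l.
  rewrite -/(G 0%N) -/(D n).
  have -> : \sum_(0 <= k < n) (normc (diff_prod q zeta w k) / normc (gap q w k.+1)) = \sum_(0 <= k < n) a k by [].
  lra.
apply/andP; split.
  rewrite ler_pdivlMr ?expR_gt0 //.
  have dl : D n <= 2 * (K' * N A) by apply: (normc_diff_prod_le cl) => i j; exact: HK'.
  have h5 : expR (n%:R * I - B1 * rate n) <= expR (rate n) * N A.
    apply: le_trans (Dlo n mn) _; apply: (le_trans dl); rewrite mulrA ler_wpM2r ?(mnorm_ge0 Nnorm) //.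
    by have := h4 n n4n; rewrite mul0r addr0.
  have h6 : expR (n%:R * I - B1 * rate n - rate n) <= N A.
    by rewrite expRD expRN ler_pdivrMr ?expR_gt0 // [N A * _]mulrC.
  apply: le_trans h6; rewrite -expRD ler_expR.
  have : 0 <= 3 * B2 * rate n by rewrite !mulr_ge0 // ltW.
  lra.
rewrite ler_pdivrMr ?expR_gt0 //.
apply: le_trans (HK A _ entries) _.
rewrite mulrA.
have -> : K * (2 / G 0%N + 2 * q%:R * A0 + 1 + 2 * q%:R * n%:R) = c1 + c2 * n%:R.
  by rewrite /c1 /c2; ring.
apply: (@le_trans _ _ (expR (rate n) * L)).
  by rewrite ler_wpM2r ?expR_ge0 // h3.
rewrite /L -!expRD ler_expR /B4; lra.
Qed.
End Growth.

Theorem theorem3p5 (R : realType) (q : nat) (zeta : 'I_2 -> seq 'I_2)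
    (N : 'M[R[i]]_2 -> R) :
  (2 <= q)%N ->
  is_substitution zeta ->
  constant_length zeta q ->
  primitive_subst zeta ->
  aperiodic_subst zeta ->
  is_matrix_norm N ->
  exists2 B : R, 0 < B &
    {ae @lebesgue_measure R, forall w : R, 0 <= w < 1 ->
      exists2 n0 : nat, (0 < n0)%N &
        forall n : nat, (n0 <= n)%N ->
          expR (- (B * Num.sqrt (n%:R * ln (ln n%:R))))
            <= N (cocycle zeta (const_mx w) n) / expR (n%:R * lyapunov N zeta)
            <= expR (B * Num.sqrt (n%:R * ln (ln n%:R)))}.
Proof.
move=> q2 _ cl _ ap Nnorm.
have lead1 := diff_poly_lead R cl (aperiodic_subst_neq q2 cl ap).
have [I [B1 [I0 B10 H1]]] := lil_poly q2 lead1.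
have n11 : normc (1 : R[i]) <= 1 by rewrite normc1.
have [B2 B20 H2] := lil_lnd q2 n11.
have qn0 j : q%:R ^+ j != 0 :> R by rewrite expf_neq0 // pnatr_eq0 -lt0n ltnW.
have H3 : {ae @lebesgue_measure R, forall w, forall j, e (q%:R ^+ j * w) != 1 :> R[i]}.
  by apply/ae_foralln => j; exact: ae_e_neq.
have H23 := ae_imply2 (fun x h1 h2 => conj h1 h2) H2 H3.
have growth : {ae @lebesgue_measure R, forall w : R,
    exists2 n0 : nat, (0 < n0)%N & forall n, (n0 <= n)%N ->
    expR (- ((B1 + 3 * B2 + 1) * lil_rate R n))
      <= N (cocycle zeta (const_mx w) n) / expR (n%:R * I)
      <= expR ((B1 + 3 * B2 + 1) * lil_rate R n)}.
  apply: ae_imply2 H1 H23 => w [g1 g2] [g3 g4].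
  exact: (cocycle_growth q2 cl Nnorm I0 B10 B20 g1 g4 g2 g3).
have lyapI : lyapunov N zeta = I.
  have aeI : {ae @lebesgue_measure R, forall w, pointwise_lyapunov N zeta w = I%:E}.
    by apply: (ae_imply2 _ growth growth) => w g _; exact: limn_esup_exponent g.
  rewrite /lyapunov; case: xgetP => [chi _ /= aechi|/(_ I)//].
  have aeF : {ae @lebesgue_measure R, forall w : R, chi = I}.
    by apply: ae_imply2 aechi aeI => w -> [].
  (* Two different constants would agree almost everywhere, on a space of positive
   measure. *)
  have [//|ne] := pselect (chi = I).
  have : (@lebesgue_measure R).-negligible setT.
    by apply: negligibleS aeF => w _ /=.
  move=> /(measure_negligible measurableT).
  move=> h; have := @lebesgue_measure_itv R `[0, 1]; rewrite /= lte_fin ltr01.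
  have : (@lebesgue_measure R `[0%R, 1%R]%classic <= @lebesgue_measure R setT)%E.
    by apply: le_measure; rewrite ?inE.
  rewrite h => /[swap] ->; rewrite -EFinD subr0 lee_fin ler10.
  by [].
exists (B1 + 3 * B2 + 1); first by lra.
by rewrite lyapI; apply: (ae_imply2 _ growth growth) => w g _ _.
Qed.
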